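(* Let $n_1\le n_2$, let $\Phi:\mathbb{R}^{n_1\times n_2}\to\mathbb{R}^m$ be a linear operator, and for $(B,\mu)\in\mathbb{R}^m\times\mathbb{R}_{++}$ let $$S(B,\mu)=\mathrm{argmin}\left\{\frac{1}{2\mu}\|\Phi X-B\|^2+\|X\|_*\;\middle|\;X\in\mathbb{R}^{n_1\times n_2}\right\}.$$ Let $(\bar B,\bar\mu)\in\mathbb{R}^m\times\mathbb{R}_{++}$, let $\bar X\in S(\bar B,\bar\mu)$, and put $\bar Y=-\frac{1}{\bar\mu}\Phi^*(\Phi\bar X-\bar B)$, $p=p(\bar Y)$ (the number of singular values of $\bar Y$ equal to $1$). Let $(\bar U,\bar V)\in\mathcal{O}(\bar X)\cap\mathcal{O}(\bar Y)$ be from a simultaneous ordered singular value decomposition of $\bar X$ and $\bar Y$. Then the following are equivalent: (i) $\mathrm{Ker}\,\Phi\cap\bar U\begin{pmatrix}\mathbb{S}^p&0\\0&0\end{pmatrix}\bar V^T=\{0\}$. (ii) The solution mapping $S$ is single-valued and Lipschitz continuous around $(\bar B,\bar\mu)$ with $S(\bar B,\bar\mu)=\bar X$. (iii) The solution mapping $S$ is single-valued around $(\bar B,\bar\mu)$ with $S(\bar B,\bar\mu)=\bar X$.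
   Context: $\mathbb{R}_{++}=(0,\infty)$. $\|X\|_*$ is the nuclear norm (sum of the singular values of $X$). $\Phi^*$ is the adjoint of $\Phi$ with respect to the trace inner product. Singular values are listed in nonincreasing order $\sigma_1(X)\ge\dots\ge\sigma_{n_1}(X)$. For $X\in\mathbb{R}^{n_1\times n_2}$, $\mathcal{O}(X)$ is the set of all pairs $(U,V)$ of orthogonal matrices $U\in\mathbb{R}^{n_1\times n_1}$, $V\in\mathbb{R}^{n_2\times n_2}$ with $X=U\begin{pmatrix}\Sigma&0\\0&0\end{pmatrix}_{n_1\times n_2}V^T$, where $\Sigma$ is the diagonal matrix of the positive singular values of $X$ in nonincreasing order. $p(Y)=\#\{i\in\{1,\dots,n_1\}:\sigma_i(Y)=1\}$. If $\bar Y\in\partial\|\bar X\|_*$ (which holds here by optimality of $\bar X$), then $\mathcal{O}(\bar X)\cap\mathcal{O}(\bar Y)\neq\emptyset$, and for $(\bar U,\bar V)$ in it $\bar X=\bar U\begin{pmatrix}\Sigma&0\\0&0\end{pmatrix}\bar V^T$, $\bar Y=\bar U\begin{pmatrix}I_p&0&0\\0&\Lambda&0\end{pmatrix}\bar V^T$ with $\Lambda\in\mathbb{R}^{(n_1-p)\times(n_1-p)}$ diagonal containing the singular values of $\bar Y$ in $[0,1)$ (simultaneous ordered singular value decomposition). $\mathbb{S}^p$ is the space of $p\times p$ symmetric matrices, and $\bar U\begin{pmatrix}\mathbb{S}^p&0\\0&0\end{pmatrix}\bar V^T=\left\{\bar U\begin{pmatrix}A&0\\0&0\end{pmatrix}_{n_1\times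 n_2}\bar V^T: A\in\mathbb{S}^p\right\}$. ''Around $(\bar B,\bar\mu)$'' means on some neighborhood of $(\bar B,\bar\mu)$ in $\mathbb{R}^m\times\mathbb{R}_{++}$. *)

(* Defs.v *)
From HB Require Import structures.
From mathcomp Require Import all_boot all_order all_algebra.
From mathcomp Require Import complex.
From mathcomp Require Import boolp classical_sets reals topology normedtype.

Set Implicit Arguments.
Unset Strict Implicit.
Unset Printing Implicit Defensive.

Import Order.TTheory GRing.Theory Num.Theory.
Import numFieldNormedType.Exports.

Local Open Scope classical_set_scope.
Local Open Scope ring_scope.

(* [fnorm] is the Frobenius norm, hence the Euclidean norm on column vectors;
   the library's norm on matrices is the max norm. *)
Definition trdot (R : realType) (m n : nat) (A B : 'M[R]_(m, n)) : R :=
  \tr (A^T *m B).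

Definition fnorm (R : realType) (m n : nat) (A : 'M[R]_(m, n)) : R :=
  Num.sqrt (trdot A A).

Lemma trdotE (R : realType) (m n : nat) (A B : 'M[R]_(m, n)) :
  trdot A B = \sum_i \sum_j A i j * B i j.
Proof.
rewrite /trdot /mxtrace exchange_big /=; apply: eq_bigr => j _.
by rewrite mxE; apply: eq_bigr => i _; rewrite mxE.
Qed.

(* For an m x n matrix with m <= n, the m singular values are the square roots
   of the eigenvalues of X X^T, counted with multiplicity. *)
Definition is_singvals (R : realType) (m n : nat) (X : 'M[R]_(m, n))
    (s : 'rV[R]_m) : Prop :=
  [/\ forall i, 0 <= s 0 i,
      forall i j : 'I_m, (i <= j)%N -> s 0 j <= s 0 i
    & char_poly (X *m X^T) = \prod_(i < m) ('X - (s 0 i ^+ 2)%:P)].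

(* Existence and uniqueness: [singvalsP] and [is_singvals_inj]. *)
Definition singvals (R : realType) (m n : nat) (X : 'M[R]_(m, n)) : 'rV[R]_m :=
  xget 0 [set s | is_singvals X s].

Lemma gram_eigenvalues (R : realType) (m n : nat) (X : 'M[R]_(m, n)) :
  exists2 e : 'I_m -> R,
    (forall i, 0 <= e i) & char_poly (X *m X^T) = \prod_(i < m) ('X - (e i)%:P).
Proof.
pose C : numClosedFieldType := complex.complex R.
pose f : {rmorphism R -> C} := real_complex R.
pose Xc : 'M[C]_(m, n) := map_mx f X; pose A : 'M[C]_m := map_mx f (X *m X^T).
have conjf (x : R) : Num.conj (f x) = f x.
  by rewrite /= /real_complex_def; apply/eqP;
     rewrite eq_complex /= oppr0 !eqxx.
have XcT : map_mx Num.conj (Xc^T) = Xc^T.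
  by apply/matrixP => i j; rewrite !mxE; apply: conjf.
have AE : A = Xc *m map_mx Num.conj Xc^T 
  by rewrite XcT /A map_mxM; congr (_ *m _); apply/matrixP => i j; rewrite !mxE.
have Ar : A \is a realmx.
  by apply/mxOverP => i j; rewrite mxE; apply/CrealP/conjf.
have Asym : A \is symmetricmx.
  apply/is_hermitianmxP; rewrite expr0 scale1r map_mx_id // /A.
  have {1}-> : X *m X^T = (X *m X^T)^T by rewrite trmx_mul trmxK.
  by apply/matrixP => i j; rewrite !mxE.
have Ah := realsym_hermsym Asym Ar.
have /orthomx_spectralP := hermitian_normalmx Ah.
set P := spectralmx A; set d := spectral_diag A => AP.
have Pu : P \is unitarymx by exact: spectral_unitarymx.
have PU : P \in unitmx by exact: unitarymx_unit.
have dE : diag_mx d = (P *m Xc) *m map_mx Num.conj (P *m Xc)^T.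
  rewrite trmx_mul map_mxM -!mulmxA [Xc *m _]mulmxA -AE -invmx_unitary // AP.
  by rewrite !mulmxA mulmxV // mul1mx mulmxK.
have d_ge0 i : 0 <= d 0 i.
  have := congr1 (fun M : 'M[C]_m => M i i) dE; rewrite mxE eqxx mulr1n => ->.
  rewrite mxE; apply: sumr_ge0 => k _; rewrite ![map_mx _ _ _ _]mxE [_^T _ _]mxE.
  exact: mul_conjC_ge0.
have dRe i : f (complex.Re (d 0 i)) = d 0 i.
  rewrite /f /=; have := d_ge0 i; case: (d 0 i) => a b.
  by rewrite lecE /= => /andP[/eqP -> _].
exists (fun i => complex.Re (d 0 i)) => [i|].
  by have := d_ge0 i; rewrite lecE /= => /andP[].
apply: (map_poly_inj f); rewrite map_char_poly -/A rmorph_prod /=.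
under eq_bigr => i _ do rewrite rmorphB /= map_polyX map_polyC /= dRe.
rewrite -[RHS](_ : char_poly (diag_mx d) = _); last first.
  rewrite char_poly_trig ?diag_mx_is_trig //.
  by apply: eq_bigr => i _; rewrite mxE eqxx.
rewrite /char_poly /char_poly_mx.
have -> : 'X%:M - map_mx polyC A =
    map_mx polyC (invmx P) *m ('X%:M - map_mx polyC (diag_mx d)) *m
    map_mx polyC P.
  rewrite mulmxBr mulmxBl -!map_mxM -AP mul_mx_scalar -scalemxAl -map_mxM.
  by rewrite mulVmx // map_mx1 scalemx1.
rewrite !det_mulmx mulrAC -det_mulmx -map_mxM mulVmx // map_mx1 det1.
by rewrite mul1r.
Qed.

Lemma is_singvals_exists (R : realType) (m n : nat) (X : 'M[R]_(m, n)) :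
  exists s, is_singvals X s.
Proof.
have [e e_ge0 eP] := gram_eigenvalues X.
pose l := sort >=%R [seq Num.sqrt (e i) | i <- enum 'I_m].
have sl : size l = m by rewrite size_sort size_map size_enum_ord.
have lmem i : (i < m)%N -> l`_i \in [seq Num.sqrt (e i) | i <- enum 'I_m].
  by move=> im; rewrite -(mem_sort >=%R) mem_nth // sl.
exists (\row_i l`_i); split => [i|i j ij|].
- by rewrite mxE; have /mapP[k _ ->] := lmem i (ltn_ord i); apply: sqrtr_ge0.
- rewrite !mxE.
  have ge_tr : transitive (>=%R : rel R) by move=> a b c ba ac; exact: le_trans ac ba.
  have ge_tot : total (>=%R : rel R) by move=> a b; exact: le_total.
  apply: (sorted_leq_nth ge_tr _ 0 (sort_sorted ge_tot _)) => //.
  - by move=> a; exact: lexx.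
  - by rewrite inE sl.
  - by rewrite inE sl.
- rewrite eP.
  transitivity
    (\prod_(x <- [seq Num.sqrt (e i) | i <- enum 'I_m]) ('X - (x ^+ 2)%:P)).
    rewrite big_map big_enum; apply: eq_bigr => i _.
    by rewrite sqr_sqrtr.
  rewrite -(perm_big _ (permEl (perm_sort >=%R _))) /= -/l.
  rewrite (big_nth 0) sl big_mkord; apply: eq_bigr => i _.
  by rewrite mxE.
Qed.

Lemma singvalsP (R : realType) (m n : nat) (X : 'M[R]_(m, n)) :
  is_singvals X (singvals X).
Proof.
exact: (@xgetPex _ 0 [set s | is_singvals X s] (is_singvals_exists X)).
Qed.

Lemma is_singvals_inj (R : realType) (m n : nat) (X : 'M[R]_(m, n))
    (s t : 'rV[R]_m) : is_singvals X s -> is_singvals X t -> s = t.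
Proof.
move=> [s0 sdec sX] [t0 tdec tX].
pose ls (u : 'rV[R]_m) := [seq u 0 i ^+ 2 | i <- enum 'I_m].
have prodE (u : 'rV[R]_m) : \prod_(i < m) ('X - (u 0 i ^+ 2)%:P) = \prod_(x <- ls u) ('X - x%:P).
  by rewrite big_map big_enum.
have pst : perm_eq (ls s) (ls t).
  by apply: prod_XsubC_eq; rewrite -!prodE -sX -tX.
have srt (u : 'rV[R]_m) : (forall i, 0 <= u 0 i) ->
    (forall i j : 'I_m, (i <= j)%N -> u 0 j <= u 0 i) -> sorted >=%R (ls u).
  move=> u0 udec; rewrite sorted_map.
  have : sorted ltn (map val (enum 'I_m)) by rewrite val_enum_ord iota_ltn_sorted.
  rewrite sorted_map; apply: sub_sorted => i j /= /ltnW ij.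
  by rewrite ler_pXn2r ?nnegrE ?u0 // udec.
have ge_tr : transitive (>=%R : rel R) by move=> a b c ba ac; exact: le_trans ac ba.
have ge_as : antisymmetric (>=%R : rel R).
  by move=> a b /andP[ba ab]; apply/le_anti/andP; split.
have E := sorted_eq ge_tr ge_as (srt s s0 sdec) (srt t t0 tdec) pst.
apply/rowP => i; move/eq_in_map: E => /(_ i); rewrite mem_enum => /(_ isT).
by move/eqP; rewrite eqrXn2 // => /eqP.
Qed.

Definition nucnorm (R : realType) (m n : nat) (X : 'M[R]_(m, n)) : R :=
  \sum_(i < m) singvals X 0 i.

Definition orthogonal_mx (R : realType) (n : nat) (U : 'M[R]_n) : Prop :=
  U^T *m U = 1%:M.

(* The m x n matrix (Sigma 0; 0 0): as the positive singular values come first,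
   the remaining diagonal entries are the vanishing singular values. *)
Definition singvals_mx (R : realType) (m n : nat) (X : 'M[R]_(m, n)) :
    'M[R]_(m, n) :=
  \matrix_(i, j) (if i == j :> nat then singvals X 0 i else 0).

(* The set O(X) of ordered singular value decompositions of X. *)
Definition osvd (R : realType) (m n : nat) (X : 'M[R]_(m, n)) :
    set ('M[R]_m * 'M[R]_n) :=
  [set UV | [/\ orthogonal_mx UV.1, orthogonal_mx UV.2
              & X = UV.1 *m singvals_mx X *m UV.2^T]].

Definition num_singvals1 (R : realType) (m n : nat) (Y : 'M[R]_(m, n)) : nat :=
  #|[pred i : 'I_m | singvals Y 0 i == 1]|.

(* [pid_mx p *m A *m pid_mx p] is the block matrix (A 0; 0 0) when p <= m and
   p <= n. *)
Definition sym_block (R : realType) (m n p : nat) (U : 'M[R]_m) (V : 'M[R]_n) :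
    set 'M[R]_(m, n) :=
  [set U *m (pid_mx p *m A *m pid_mx p) *m V^T | A in [set A : 'M[R]_p | A^T = A]].

(* See [adjointP] for the defining property. *)
Definition adjoint (R : realType) (m n k : nat)
    (Phi : {linear 'M[R]_(m, n) -> 'cV[R]_k}) (z : 'cV[R]_k) : 'M[R]_(m, n) :=
  \matrix_(i, j) trdot (Phi (delta_mx i j)) z.

Lemma adjointP (R : realType) (m n k : nat)
    (Phi : {linear 'M[R]_(m, n) -> 'cV[R]_k}) X z :
  trdot (Phi X) z = trdot X (adjoint Phi z).
Proof.
rewrite [RHS]trdotE {1}(matrix_sum_delta X) /trdot.
rewrite linear_sum !linear_sum /= mulmx_suml linear_sum /=.
apply: eq_bigr => i _.
rewrite linear_sum !linear_sum /= mulmx_suml linear_sum /=.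
by apply: eq_bigr => j _; rewrite mxE linearZ linearZ /= -scalemxAl linearZ.
Qed.

Definition argmin (R : realType) (T : Type) (f : T -> R) : set T :=
  [set x | forall y, f x <= f y].

Definition nucobj (R : realType) (m n k : nat)
    (Phi : {linear 'M[R]_(m, n) -> 'cV[R]_k}) (B : 'cV[R]_k) (mu : R)
    (X : 'M[R]_(m, n)) : R :=
  (2 * mu)^-1 * fnorm (Phi X - B) ^+ 2 + nucnorm X.

Definition nucsol (R : realType) (m n k : nat)
    (Phi : {linear 'M[R]_(m, n) -> 'cV[R]_k}) (q : 'cV[R]_k * R) :
    set 'M[R]_(m, n) :=
  argmin (nucobj Phi q.1 q.2).

(* Euclidean distance on R^k x R. *)
Definition pdist (R : realType) (k : nat) (q q' : 'cV[R]_k * R) : R :=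
  Num.sqrt (fnorm (q.1 - q'.1) ^+ 2 + (q.2 - q'.2) ^+ 2).

(* Neighborhoods of q in R^k x (0, +oo). *)
Definition pos_nbhs (R : realType) (k : nat) (q : 'cV[R]_k * R)
    (N : set ('cV[R]_k * R)) : Prop :=
  nbhs q N /\ N `<=` [set q' | 0 < q'.2].

Definition single_valued_on (T U : Type) (S : T -> set U) (N : set T) : Prop :=
  forall q, N q -> exists x, S q = [set x].

(* For a set-valued map which is single-valued on N. *)
Definition lipschitz_sv_on (R : realType) (m n k : nat)
    (S : 'cV[R]_k * R -> set 'M[R]_(m, n)) (N : set ('cV[R]_k * R)) : Prop :=
  exists L : R, forall q q' X X', N q -> N q' -> S q X -> S q' X' ->
    fnorm (X - X') <= L * pdist q q'.

(* Main.v *)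
Require Import Defs.
From HB Require Import structures.
From mathcomp Require Import all_boot all_order all_algebra.
From mathcomp Require Import ring lra.
From mathcomp Require Import boolp classical_sets reals topology normedtype.
From mathcomp Require Import derive.

Set Implicit Arguments.
Unset Strict Implicit.
Unset Printing Implicit Defensive.

Import Order.TTheory GRing.Theory Num.Theory.
Import numFieldNormedType.Exports.

Local Open Scope classical_set_scope.
Local Open Scope ring_scope.

(** Write [Y] for the dual matrix [- (1/mu) Phi^* (Phi X - B)] of a solution
    [X].  Convexity makes [X] a solution exactly when [Y] is a subgradient of
    the nuclear norm at [X], and then two facts about [(X, Y)] suffice for
    everything: the subdifferential is monotone, and [X = Y X^T Y]
    ([subgradient_fixed]).  The second one comes from a factorization
    [X = L S] with [|L|^2 = |S|^2 = nucnorm X] ([nucnorm_decomposition], a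
    consequence of the spectral theorem for [X X^T]): equality in
    Cauchy-Schwarz gives [Y S^T = L] and [L^T Y = S].

    The equation [H = Ybar H^T Ybar] is linear in [H], and in the coordinates
    of the singular value decomposition of [Ybar] its solutions are symmetric
    p x p blocks ([fixed_sym_block]).  So (i) says that
    [H |-> (Phi H, H - Ybar H^T Ybar)] is injective, that is
    [|H| <= K (|Phi H| + |H - Ybar H^T Ybar|)].

    (i) => (ii).  Apply this to [H = X - X'] for solutions [X], [X'] at
    parameters near [(Bbar, mubar)], at distance [d] of each other.
    Subtracting [X = Y X^T Y] and [X' = Y' X'^T Y'] bounds the second term by
    [O(|Y - Y'|)] plus a small multiple of [|X - X'|], and [Y - Y'] is
    [O(|Phi (X - X')| + d)].  Monotonicity gives
    [|Phi (X - X')|^2 = O(|X - X'| d)].  Together: [|X - X'| = O(d)], which is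
    the Lipschitz estimate and, for [d = 0], uniqueness
    ([nucsol_lipschitz]).  Existence is Weierstrass's theorem
    ([nucsol_exists]).

    (iii) => (i).  Let [A] be a symmetric block whose embedding [M A] lies in
    the kernel of [Phi].  Adding to [Xbar] a small positive semidefinite block
    keeps [Ybar] a subgradient ([subgradient_add_block]).  With the blocks
    [t (1 - A)^2] and [t (1 + A)^2], whose difference is [4 t A], both new
    matrices have the same image under [Phi], hence solve the same perturbed
    problem ([nucsol_two_solutions]); if that problem has a single solution,
    then [M A = 0]. *)

(** * The Frobenius inner product and norm *)

Section Frobenius.
Variable R : realType.
Implicit Types m n k : nat.

Lemma trdotC m n (A B : 'M[R]_(m, n)) : trdot A B = trdot B A.
Proof. by rewrite /trdot -mxtrace_tr trmx_mul trmxK. Qed.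

Lemma trdotDl m n (A B C : 'M[R]_(m, n)) :
  trdot (A + B) C = trdot A C + trdot B C.
Proof. by rewrite /trdot linearD mulmxDl mxtraceD. Qed.

Lemma trdotZl m n a (A B : 'M[R]_(m, n)) : trdot (a *: A) B = a * trdot A B.
Proof. by rewrite /trdot linearZ -scalemxAl mxtraceZ. Qed.

Lemma trdotNl m n (A B : 'M[R]_(m, n)) : trdot (- A) B = - trdot A B.
Proof. by rewrite -scaleN1r trdotZl mulN1r. Qed.

Lemma trdotDr m n (A B C : 'M[R]_(m, n)) :
  trdot A (B + C) = trdot A B + trdot A C.
Proof. by rewrite trdotC trdotDl !(trdotC _ A). Qed.

Lemma trdotZr m n a (A B : 'M[R]_(m, n)) : trdot A (a *: B) = a * trdot A B.
Proof. by rewrite trdotC trdotZl trdotC. Qed.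

Lemma trdotNr m n (A B : 'M[R]_(m, n)) : trdot A (- B) = - trdot A B.
Proof. by rewrite trdotC trdotNl trdotC. Qed.

Lemma trdot0l m n (A : 'M[R]_(m, n)) : trdot 0 A = 0.
Proof. by rewrite -[X in trdot X _](scale0r A) trdotZl mul0r. Qed.

Lemma trdot0r m n (A : 'M[R]_(m, n)) : trdot A 0 = 0.
Proof. by rewrite trdotC trdot0l. Qed.

Definition trdot_lin := (trdotDl, trdotDr, trdotNl, trdotNr, trdotZl, trdotZr).

Lemma trdot_tr m n (A B : 'M[R]_(m, n)) : trdot A^T B^T = trdot A B.
Proof. by rewrite /trdot mxtrace_mulC -mxtrace_tr trmx_mul !trmxK. Qed.

Lemma trdot_mull m n k (A : 'M[R]_(m, k)) (B : 'M[R]_(k, n)) C :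
  trdot (A *m B) C = trdot B (A^T *m C).
Proof. by rewrite /trdot trmx_mul mulmxA. Qed.

Lemma trdot_mulr m n k (A : 'M[R]_(m, k)) (B : 'M[R]_(k, n)) C :
  trdot (A *m B) C = trdot A (C *m B^T).
Proof. by rewrite -trdot_tr trmx_mul trdot_mull trmxK -trdot_tr trmx_mul !trmxK. Qed.

Lemma trdot_ge0 m n (A : 'M[R]_(m, n)) : 0 <= trdot A A.
Proof.
by rewrite trdotE; do 2!(apply: sumr_ge0 => ? _); rewrite -expr2 sqr_ge0.
Qed.

Lemma trdot_eq0 m n (A : 'M[R]_(m, n)) : (trdot A A == 0) = (A == 0).
Proof.
apply/eqP/eqP => [|->]; last by rewrite trdot0l.
rewrite trdotE => A0; apply/matrixP => i j; rewrite mxE.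
have ge0 (i0 : 'I_m) : 0 <= \sum_j A i0 j * A i0 j.
  by apply: sumr_ge0 => l _; rewrite -expr2 sqr_ge0.
have /(_ i isT) := psumr_eq0P (fun i _ => ge0 i) A0.
move/psumr_eq0P => /(_ _ j isT)/eqP; rewrite mulf_eq0 orbb => Aij.
by apply/eqP/Aij => l _; rewrite -expr2 sqr_ge0.
Qed.

Lemma fnorm_ge0 m n (A : 'M[R]_(m, n)) : 0 <= fnorm A.
Proof. exact: sqrtr_ge0. Qed.
Hint Resolve fnorm_ge0 : core.

Lemma sqr_fnorm m n (A : 'M[R]_(m, n)) : fnorm A ^+ 2 = trdot A A.
Proof. by rewrite sqr_sqrtr ?trdot_ge0. Qed.

Lemma fnorm_eq0 m n (A : 'M[R]_(m, n)) : (fnorm A == 0) = (A == 0).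
Proof. by rewrite -sqrf_eq0 sqr_fnorm trdot_eq0. Qed.

Lemma fnorm0 m n : fnorm (0 : 'M[R]_(m, n)) = 0.
Proof. by apply/eqP; rewrite fnorm_eq0. Qed.

Lemma ler_fnorm m n k l (A : 'M[R]_(m, n)) (B : 'M[R]_(k, l)) :
  (fnorm A <= fnorm B) = (trdot A A <= trdot B B).
Proof. by rewrite -!sqr_fnorm ler_pXn2r ?nnegrE. Qed.

Lemma fnormZ m n a (A : 'M[R]_(m, n)) : fnorm (a *: A) = `|a| * fnorm A.
Proof.
by rewrite /fnorm trdotZl trdotZr mulrA -expr2 sqrtrM ?sqr_ge0// sqrtr_sqr.
Qed.

Lemma fnormN m n (A : 'M[R]_(m, n)) : fnorm (- A) = fnorm A.
Proof. by rewrite -scaleN1r fnormZ normrN1 mul1r. Qed.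

Lemma fnorm_tr m n (A : 'M[R]_(m, n)) : fnorm A^T = fnorm A.
Proof. by rewrite /fnorm trdot_tr. Qed.

Lemma sqr_trdot_le m n (A B : 'M[R]_(m, n)) :
  trdot A B ^+ 2 <= trdot A A * trdot B B.
Proof.
have [->|B0] := eqVneq B 0; first by rewrite !trdot0r expr0n mulr0.
have b_gt0 : 0 < trdot B B by rewrite lt0r trdot_eq0 B0 trdot_ge0.
rewrite -(ler_pM2l b_gt0) -subr_ge0.
have := trdot_ge0 (trdot B B *: A - trdot A B *: B).
rewrite !trdot_lin (trdotC B A); congr (0 <= _); ring.
Qed.

Lemma trdot_le m n (A B : 'M[R]_(m, n)) : trdot A B <= fnorm A * fnorm B.
Proof.
rewrite (le_trans (ler_norm _))// -(@ler_pXn2r _ 2) ?nnegrE ?mulr_ge0//.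
by rewrite real_normK ?num_real// exprMn !sqr_fnorm sqr_trdot_le.
Qed.

Lemma trdot_ge m n (A B : 'M[R]_(m, n)) : - (fnorm A * fnorm B) <= trdot A B.
Proof. by rewrite lerNl -trdotNl -(fnormN A) trdot_le. Qed.

Lemma ler_fnormD m n (A B : 'M[R]_(m, n)) : fnorm (A + B) <= fnorm A + fnorm B.
Proof.
rewrite -(@ler_pXn2r _ 2) ?nnegrE ?addr_ge0// sqrrD !sqr_fnorm !trdot_lin.
rewrite (trdotC B A); have := trdot_le A B; lra.
Qed.

Lemma ler_fnormB m n (A B : 'M[R]_(m, n)) : fnorm (A - B) <= fnorm A + fnorm B.
Proof. by rewrite -(fnormN B) ler_fnormD. Qed.

Lemma fnormM m n k (A : 'M[R]_(m, k)) (B : 'M[R]_(k, n)) :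
  fnorm (A *m B) <= fnorm A * fnorm B.
Proof.
rewrite -(@ler_pXn2r _ 2) ?nnegrE ?mulr_ge0// exprMn !sqr_fnorm.
have -> : trdot A A = \sum_i trdot (row i A) (row i A).
  rewrite trdotE; apply: eq_bigr => i _; rewrite trdotE big_ord1.
  by apply: eq_bigr => j _; rewrite mxE.
have -> : trdot B B = \sum_j trdot (col j B)^T (col j B)^T.
  rewrite -trdot_tr trdotE; apply: eq_bigr => j _; rewrite trdotE big_ord1.
  by apply: eq_bigr => i _; rewrite !mxE.
rewrite trdotE mulr_suml; apply: ler_sum => i _; rewrite mulr_sumr.
apply: ler_sum => j _; rewrite -expr2.
have -> : (A *m B) i j = trdot (row i A) (col j B)^T.
  by rewrite mxE trdotE big_ord1; apply: eq_bigr => l _; rewrite !mxE.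
exact: sqr_trdot_le.
Qed.

Lemma ler_entry_fnorm m n (X : 'M[R]_(m, n)) i j : `|X i j| <= fnorm X.
Proof.
rewrite -(@ler_pXn2r _ 2) ?nnegrE// sqr_fnorm real_normK ?num_real// trdotE.
rewrite (bigD1 i)//= (bigD1 j)//= expr2 -addrA lerDl addr_ge0 ?sumr_ge0//.
  by move=> ? _; rewrite -expr2 sqr_ge0.
by move=> ? _; apply: sumr_ge0 => ? _; rewrite -expr2 sqr_ge0.
Qed.

(** Expanding in the basis of elementary matrices bounds a linear map by its
    values on that basis. *)
Lemma linear_fnorm_bounded m n k l (f : {linear 'M[R]_(m, n) -> 'M[R]_(k, l)}) :
  exists2 K, 0 <= K & forall X, fnorm (f X) <= K * fnorm X.
Proof.
exists (\sum_i \sum_j fnorm (f (delta_mx i j))) => [|X].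
  by do 2!(apply: sumr_ge0 => ? _).
have fsum I (r : seq I) (F : I -> 'M[R]_(k, l)) :
    fnorm (\sum_(i <- r) F i) <= \sum_(i <- r) fnorm (F i).
  elim/big_ind2: _ => [|A a B b Aa Bb|//]; first by rewrite fnorm0.
  by rewrite (le_trans (ler_fnormD _ _))// lerD.
rewrite {1}(matrix_sum_delta X) linear_sum (le_trans (fsum _ _ _))// mulr_suml.
apply: ler_sum => i _; rewrite linear_sum (le_trans (fsum _ _ _))// mulr_suml.
by apply: ler_sum => j _; rewrite linearZ fnormZ mulrC ler_wpM2l// ler_entry_fnorm.
Qed.

(** The bound is that of a linear left inverse. *)
Lemma injective_fnorm_bounded m n k l
    (f : {linear 'M[R]_(m, n) -> 'M[R]_(k, l)}) :
  (forall X, f X = 0 -> X = 0) ->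
  exists2 K, 0 <= K & forall X, fnorm X <= K * fnorm (f X).
Proof.
move=> f_inj; pose h := linfun f.
have h0 : lker h == 0%VS.
  apply/eqP/vspaceP => X; rewrite memv0 memv_ker lfunE /=.
  by apply/eqP/eqP => [/f_inj|->] //; rewrite linear0.
have [K K0 hK] := linear_fnorm_bounded (h^-1)%VF.
exists K => // X; have hV := lker0_lfunK h0 X; rewrite lfunE /= in hV.
by rewrite -(congr1 (@fnorm R m n) hV); exact: hK.
Qed.

End Frobenius.
#[global] Hint Extern 0 (is_true (0 <= fnorm _)) => exact: fnorm_ge0 : core.

(** * The spectral theorem for real symmetric matrices *)

Section Spectral.
Variable R : realType.

Lemma trdot_rV n (a b : 'rV[R]_n) : a *m b^T = (trdot a b)%:M.
Proof.
by rewrite [a *m b^T]mx11_scalar trdotC /trdot mxtrace_mulC /mxtrace big_ord1.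
Qed.

(** The reflection in the hyperplane orthogonal to [a - b]; when [a = b] the
    convention [0^-1 = 0] makes it the identity. *)
Lemma householder n (a b : 'rV[R]_n) : trdot a a = 1 -> trdot b b = 1 ->
  exists Q : 'M[R]_n, [/\ Q^T = Q, Q *m Q = 1%:M & a *m Q = b].
Proof.
move=> a1 b1; have [w wE] : exists w : 'rV[R]_n, w = b - a by exists (b - a).
pose c := 2 / trdot w w.
exists (1%:M - c *: (w^T *m w)).
have ww : trdot w w = 2 - 2 * trdot a b.
  by rewrite wE !trdot_lin a1 b1 (trdotC b a); ring.
have aw : trdot a w = trdot a b - 1 by rewrite wE !trdot_lin a1.
have cE : w = 0 \/ c * trdot w w = 2.
  have [|w0] := eqVneq w 0; [by left|right].
  by rewrite /c divfK// trdot_eq0.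
split.
- by rewrite linearB /= trmx1 linearZ /= trmx_mul trmxK.
- rewrite mulmxBl mul1mx mulmxBr mulmx1 -scalemxAl -scalemxAr.
  rewrite mulmxA -(mulmxA _ w) trdot_rV mul_mx_scalar -scalemxAl !scalerA.
  case: cE => [->|]; first by rewrite mulmx0 !scaler0 !subr0.
  move=> ->; rewrite mulr_natr mulr2n scalerDl opprB addrK.
  by rewrite subrK.
- rewrite mulmxBr mulmx1 -scalemxAr mulmxA trdot_rV mul_scalar_mx scalerA.
  case: cE => [w0|cw]; first by rewrite w0 scaler0 subr0; apply/eqP;
    rewrite eq_sym -subr_eq0 -wE w0.
  have -> : c * trdot a w = -1 by move: cw; rewrite aw ww => cw; lra.
  by rewrite scaleN1r opprK wE addrC subrK.
Qed.

Lemma char_poly_conj n (P Q A : 'M[R]_n) : P *m Q = 1%:M ->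
  char_poly (P *m A *m Q) = char_poly A.
Proof.
move=> PQ; rewrite /char_poly /char_poly_mx.
have -> : 'X%:M - map_mx polyC (P *m A *m Q) =
    map_mx polyC P *m ('X%:M - map_mx polyC A) *m map_mx polyC Q.
  rewrite mulmxBr mulmxBl -!map_mxM mul_mx_scalar -scalemxAl -map_mxM PQ.
  by rewrite map_mx1 scalemx1.
rewrite !det_mulmx mulrAC -det_mulmx -map_mxM PQ map_mx1 det1.
by rewrite mul1r.
Qed.

(** Induction on the size: a unit eigenvector is moved to the first basis
    vector by a reflection, which splits off a 1 x 1 diagonal block. *)
Lemma symmetric_diagonalization n (A : 'M[R]_n) (e : 'rV[R]_n) :
  A^T = A -> char_poly A = \prod_(i < n) ('X - (e 0 i)%:P) ->
  exists2 P, orthogonal_mx P & A = P *m diag_mx e *m P^T.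
Proof.
elim: n A e => [|n IHn] A e As Ae.
  by exists 1%:M; [rewrite /orthogonal_mx trmx1 mulmx1|rewrite [LHS]thinmx0 [RHS]thinmx0].
have : eigenvalue A (e 0 0).
  rewrite eigenvalue_root_char Ae /root horner_prod big_ord_recl /=.
  by rewrite hornerXsubC subrr mul0r.
move=> /eigenvalueP[v vA v0].
pose u := (fnorm v)^-1 *: v.
have fv0 : fnorm v != 0 by rewrite fnorm_eq0.
have uu : trdot u u = 1.
  by rewrite /u !trdot_lin -sqr_fnorm; field.
have uA : u *m A = e 0 0 *: u by rewrite -scalemxAl vA !scalerA mulrC.
have d1 : trdot (delta_mx 0 0 : 'rV[R]_n.+1) (delta_mx 0 0) = 1.
  rewrite trdotE big_ord1 (bigD1 ord0)//= big1 ?addr0 => [|i i0].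
    by rewrite mxE !eqxx mulr1.
  by rewrite mxE (negPf i0) mulr0.
have [Q [Qs QQ dQ]] := householder d1 uu.
have QAQs : (Q *m A *m Q)^T = Q *m A *m Q by rewrite !trmx_mul Qs As mulmxA.
have dB : delta_mx 0 0 *m (Q *m A *m Q) = e 0 0 *: (delta_mx 0 0 : 'rV_n.+1).
  by rewrite !mulmxA dQ uA -scalemxAl -dQ -mulmxA QQ mulmx1.
have AE : A = Q *m (Q *m A *m Q) *m Q.
  by rewrite !mulmxA QQ mul1mx -mulmxA QQ mulmx1.
have cB : char_poly (Q *m A *m Q) = char_poly A by rewrite char_poly_conj.
move: (Q *m A *m Q) QAQs dB AE cB => B; rewrite -[n.+1]/(1 + n)%N in B *.
move=> Bs dB AE cB.
have B0 j : B 0 j = e 0 0 *+ (j == 0).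
  move/matrixP: dB => /(_ 0 j); rewrite -rowE !mxE /= => ->.
  by case: eqP => _; rewrite ?mulr1 ?mulr0.
have BE : B = block_mx (e 0 0)%:M 0 0 (drsubmx B).
  have Bul : ulsubmx B = (e 0 0)%:M.
    by apply/matrixP => i j; rewrite !ord1 !mxE lshift0 B0.
  have Bur : ursubmx B = 0.
    apply/matrixP => i j; rewrite !ord1 !mxE lshift0 B0.
    by rewrite (_ : _ == 0 = false)//; apply/eqP => /(congr1 val).
  have Bdl : dlsubmx B = 0 by rewrite -Bs -trmx_ursub Bur trmx0.
  by rewrite -[LHS]submxK Bul Bur Bdl.
have Bds : (drsubmx B)^T = drsubmx B by rewrite trmx_drsub Bs.
have /(IHn _ (\row_i e 0 (lift 0 i)) Bds)[P Po PE] :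
    char_poly (drsubmx B) = \prod_(i < n) ('X - ((\row_i e 0 (lift 0 i)) 0 i)%:P).
  move: cB; rewrite {1}BE {1}/char_poly char_block_diag_mx det_ublock Ae.
  rewrite big_ord_recl {1}/char_poly_mx det_mx11 !mxE !eqxx !mulr1n.
  move/mulfI => cB; rewrite /char_poly cB ?polyXsubC_eq0//.
  by apply: eq_bigr => i _; rewrite mxE.
pose P1 : 'M[R]_(1 + n) := block_mx 1%:M 0 0 P.
have P1o : P1^T *m P1 = 1%:M.
  rewrite /P1 tr_block_mx !trmx0 trmx1 mulmx_block !mulmx0 !mul0mx mulmx1.
  by rewrite !addr0 add0r Po -scalar_mx_block.
pose D : 'M[R]_(1 + n) := diag_mx e.
have DE : D = block_mx (e 0 0)%:M 0 0 (diag_mx (\row_i e 0 (lift 0 i))).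
  rewrite -[LHS](@submxK _ 1 n 1 n); congr block_mx.
  - by apply/matrixP => i j; rewrite !ord1 !mxE lshift0.
  - apply/matrixP => i j; rewrite !ord1 !mxE lshift0.
    by rewrite (_ : _ == _ = false)//; apply/eqP => /(congr1 val).
  - apply/matrixP => i j; rewrite !ord1 !mxE lshift0.
    by rewrite (_ : _ == _ = false)//; apply/eqP => /(congr1 val).
  - by apply/matrixP => i j; rewrite !mxE !rshift1 (inj_eq (@lift_inj _ 0)).
have PB : B = P1 *m D *m P1^T.
  rewrite DE {1}BE PE /P1 tr_block_mx !trmx0 trmx1 !mulmx_block.
  by rewrite !mulmx0 !mul0mx !mulmx1 !mul1mx !addr0 !add0r ?mul0mx.
exists (Q *m P1).
  by rewrite /orthogonal_mx trmx_mul Qs -mulmxA (mulmxA Q) QQ mul1mx.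
by rewrite AE PB -/D trmx_mul Qs !mulmxA.
Qed.

End Spectral.

(** * Duality and factorizations of the nuclear norm *)

Section NuclearNorm.
Variable R : realType.

(** Operator norm at most one.  Quantifying over matrices [u], and not only over
    rows, gives the estimates in the Frobenius norm directly. *)
Definition mx_contraction m n (W : 'M[R]_(m, n)) : Prop :=
  forall k (u : 'M[R]_(k, m)), fnorm (u *m W) <= fnorm u.

Lemma orthogonal_fnorm n (P : 'M[R]_n) k (A : 'M[R]_(n, k)) :
  orthogonal_mx P -> fnorm (P *m A) = fnorm A.
Proof.
by move=> Po; rewrite /fnorm trdot_mull mulmxA Po mul1mx.
Qed.

Lemma orthogonal_mx_tr n (P : 'M[R]_n) :
  orthogonal_mx P -> orthogonal_mx P^T.
Proof. by move=> Po; rewrite /orthogonal_mx trmxK; apply: mulmx1C. Qed.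

Lemma orthogonal_contraction n (P : 'M[R]_n) : orthogonal_mx P -> mx_contraction P.
Proof.
move=> Po k u; rewrite -fnorm_tr trmx_mul orthogonal_fnorm ?fnorm_tr//.
exact: orthogonal_mx_tr.
Qed.

Lemma contractionM m n k (A : 'M[R]_(m, n)) (B : 'M[R]_(n, k)) :
  mx_contraction A -> mx_contraction B -> mx_contraction (A *m B).
Proof. by move=> cA cB l u; rewrite mulmxA (le_trans (cB _ _)). Qed.

Lemma contraction_tr m n (A : 'M[R]_(m, n)) : mx_contraction A -> mx_contraction A^T.
Proof.
move=> cA k u; have [-> //|u0] := eqVneq (fnorm (u *m A^T)) 0.
have fu : 0 < fnorm (u *m A^T) by rewrite lt0r u0 fnorm_ge0.
rewrite -(ler_pM2l fu) -expr2 sqr_fnorm trdot_mulr trmxK trdotC.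
by rewrite (le_trans (trdot_le _ _))// ler_wpM2r// cA.
Qed.

Lemma fnorm_contraction_le m n k (A : 'M[R]_(m, n)) (u : 'M[R]_(n, k)) :
  mx_contraction A -> fnorm (A *m u) <= fnorm u.
Proof.
by move=> cA; rewrite -fnorm_tr trmx_mul -(fnorm_tr u) contraction_tr.
Qed.

(** In a singular value decomposition [X = P diag(s) W'], the square root of
    [diag(s)] is shared between the two sides, and [W = P W'].  The spectral
    theorem for [X X^T] gives [P]; then [W' = diag(s)^-1 P^T X], where
    [0^-1 = 0] takes care of the vanishing singular values. *)
Lemma nucnorm_decomposition m n (X : 'M[R]_(m, n)) :
  exists L : 'M[R]_m, exists S W : 'M[R]_(m, n),
    [/\ X = L *m S, fnorm L ^+ 2 = nucnorm X, fnorm S ^+ 2 = nucnorm X,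
        mx_contraction W & trdot X W = nucnorm X].
Proof.
have [s_ge0 _ sX] := singvalsP X; rewrite /nucnorm; move: (singvals X) s_ge0 sX.
move=> s s_ge0 sX.
have [P Po PE] : exists2 P, orthogonal_mx P &
    X *m X^T = P *m diag_mx (\row_i (s 0 i ^+ 2)) *m P^T.
  apply: symmetric_diagonalization; first by rewrite trmx_mul trmxK.
  by rewrite sX; apply: eq_bigr => i _; rewrite mxE.
have PPt : P *m P^T = 1%:M by apply: mulmx1C.
have [G GG XE] : exists2 G, G *m G^T = diag_mx (\row_i (s 0 i ^+ 2)) & X = P *m G.
  exists (P^T *m X); last by rewrite mulmxA PPt mul1mx.
  rewrite trmx_mul trmxK mulmxA -(mulmxA P^T) PE !mulmxA Po mul1mx.
  by rewrite -mulmxA Po mulmx1.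
have rowG i : \sum_j G i j ^+ 2 = s 0 i ^+ 2.
  move/matrixP: GG => /(_ i i); rewrite !mxE eqxx mulr1n => <-.
  by apply: eq_bigr => j _; rewrite !mxE expr2.
have G0 i j : s 0 i = 0 -> G i j = 0.
  move=> si0; have := rowG i; rewrite si0 expr0n /= => /psumr_eq0P.
  by move=> /(_ (fun k _ => sqr_ge0 _) j isT)/eqP; rewrite sqrf_eq0 => /eqP.
have diagE a (i : 'I_m) (j : 'I_n) : (diag_mx a *m G) i j = a 0 i * G i j.
  by rewrite mul_diag_mx mxE.
have trdiag (a b : 'rV[R]_m) :
    trdot (diag_mx a *m G) (diag_mx b *m G) = \sum_i a 0 i * b 0 i * s 0 i ^+ 2.
  rewrite trdotE; apply: eq_bigr => i _; rewrite -rowG mulr_sumr.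
  by apply: eq_bigr => j _; rewrite !diagE; ring.
pose r : 'rV[R]_m := \row_i Num.sqrt (s 0 i).
pose r' : 'rV[R]_m := \row_i (Num.sqrt (s 0 i))^-1.
pose s' : 'rV[R]_m := \row_i (s 0 i)^-1.
have r2 i : Num.sqrt (s 0 i) ^+ 2 = s 0 i by rewrite sqr_sqrtr.
exists (P *m diag_mx r), (diag_mx r' *m G), (P *m (diag_mx s' *m G)); split.
- rewrite {1}XE -mulmxA; congr (_ *m _); rewrite mulmxA mulmx_diag.
  apply/matrixP => i j; rewrite diagE !mxE.
  have [si0|si0] := eqVneq (s 0 i) 0; first by rewrite G0// mulr0.
  by rewrite divff ?mul1r// sqrtr_eq0 -ltNge lt0r si0 s_ge0.
- rewrite orthogonal_fnorm// sqr_fnorm trdotE; apply: eq_bigr => i _.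
  rewrite (bigD1 i)//= big1 => [|j ji].
    by rewrite !mxE eqxx mulr1n -expr2 r2 addr0.
  by rewrite mxE eq_sym (negPf ji) mulr0n mul0r.
- rewrite sqr_fnorm trdiag; apply: eq_bigr => i _; rewrite !mxE.
  have [->|si0] := eqVneq (s 0 i) 0; first by rewrite expr0n mulr0.
  by rewrite -expr2 exprVn r2; field.
- apply: contractionM; first exact: orthogonal_contraction.
  move=> k u; rewrite ler_fnorm mulmxA trdot_mulr -!mulmxA.
  rewrite GG !mulmxA -!mulmxA mulmx_diag !trdotE; apply: ler_sum => i _.
  apply: ler_sum => j _; rewrite !mul_mx_diag !mxE.
  have [->|si0] := eqVneq (s 0 j) 0; first by rewrite expr0n invr0 !mulr0 -expr2 sqr_ge0.
  by rewrite le_eqVlt; apply/orP; left; apply/eqP; field.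
- rewrite {1}XE trdot_mull mulmxA Po mul1mx -{1}[G]mul1mx -diag_const_mx trdiag.
  apply: eq_bigr => i _; rewrite !mxE.
  have [->|si0] := eqVneq (s 0 i) 0; first by rewrite expr0n mulr0.
  by field.
Qed.

End NuclearNorm.

Section NuclearNormDuality.
Variables (R : realType) (m n : nat).
Implicit Types X Y Z : 'M[R]_(m, n).

(** Half of the duality between the nuclear and the operator norm; the matrix
    [W] of [nucnorm_decomposition] gives the other half. *)
Lemma contraction_nucnorm X Y : mx_contraction Y -> trdot X Y <= nucnorm X.
Proof.
have [L [S [_ [-> L2 S2 _ _]]]] := nucnorm_decomposition X => cY.
have LS : fnorm L = fnorm S by apply/eqP; rewrite -(@eqrXn2 _ 2)// L2 S2.
rewrite trdot_mull (le_trans (trdot_le _ _))// -L2 expr2 -LS ler_wpM2l//.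
by rewrite -(fnorm_tr L) cY.
Qed.

Lemma nucnorm_le X r :
  (forall W : 'M[R]_(m, n), mx_contraction W -> trdot X W <= r) -> nucnorm X <= r.
Proof. by have [_ [_ [W [_ _ _ cW <-]]]] := nucnorm_decomposition X; exact. Qed.

Lemma nucnormM_le k (A : 'M[R]_(m, k)) (B : 'M[R]_(k, n)) :
  nucnorm (A *m B) <= fnorm A * fnorm B.
Proof.
apply: nucnorm_le => W cW.
rewrite trdot_mulr (le_trans (trdot_le _ _))// ler_wpM2l//.
by rewrite -(fnorm_tr B) fnorm_contraction_le.
Qed.

Lemma nucnorm_ge0 X : 0 <= nucnorm X.
Proof.
by apply: sumr_ge0 => i _; have [] := singvalsP X.
Qed.

Lemma nucnorm0 : nucnorm (0 : 'M[R]_(m, n)) = 0.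
Proof.
apply/le_anti; rewrite nucnorm_ge0 andbT; apply: nucnorm_le => W _.
by rewrite trdot0l.
Qed.

Lemma ler_nucnormD X Z : nucnorm (X + Z) <= nucnorm X + nucnorm Z.
Proof.
by apply: nucnorm_le => W cW; rewrite trdotDl lerD// contraction_nucnorm.
Qed.

Lemma ler_nucnormZ a X : 0 <= a -> nucnorm (a *: X) <= a * nucnorm X.
Proof.
move=> a0; apply: nucnorm_le => W cW.
by rewrite trdotZl ler_wpM2l// contraction_nucnorm.
Qed.

Lemma nucnorm_le_fnorm X : nucnorm X <= fnorm (1%:M : 'M[R]_m) * fnorm X.
Proof. by rewrite -{1}(mul1mx X) nucnormM_le. Qed.

Lemma fnorm_le_nucnorm X : fnorm X <= nucnorm X.
Proof.
have [L [S [_ [XE L2 S2 _ _]]]] := nucnorm_decomposition X.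
have LS : fnorm L = fnorm S by apply/eqP; rewrite -(@eqrXn2 _ 2)// L2 S2.
by rewrite {1}XE (le_trans (fnormM _ _))// -S2 LS -expr2.
Qed.

Definition nucnorm_subgradient X Y : Prop :=
  forall Z, nucnorm X + trdot Y (Z - X) <= nucnorm Z.

Lemma subgradient_le X Y Z : nucnorm_subgradient X Y -> trdot Y Z <= nucnorm Z.
Proof.
move=> /(_ (X + Z)); rewrite addrAC subrr add0r.
by move=> /le_trans/(_ (ler_nucnormD X Z)); rewrite lerD2l.
Qed.

Lemma subgradient_trdot X Y : nucnorm_subgradient X Y -> trdot X Y = nucnorm X.
Proof.
move=> XY; apply/le_anti; rewrite trdotC (subgradient_le X XY) /=.
by have := XY 0; rewrite sub0r trdotNr nucnorm0; lra.
Qed.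

(** Testing the duality [<Y, Z> <= nucnorm Z] on [Z = u^T u Y]. *)
Lemma subgradient_contraction X Y : nucnorm_subgradient X Y -> mx_contraction Y.
Proof.
move=> XY k u; have [-> //|u0] := eqVneq (fnorm (u *m Y)) 0.
have fu : 0 < fnorm (u *m Y) by rewrite lt0r u0 fnorm_ge0.
rewrite -(ler_pM2r fu) -(fnorm_tr u) -expr2 sqr_fnorm trdot_mull trdotC trdotC.
exact: le_trans (subgradient_le _ XY) (nucnormM_le _ _).
Qed.

Lemma contraction_subgradient X Y : mx_contraction Y -> nucnorm X <= trdot X Y ->
  nucnorm_subgradient X Y.
Proof.
move=> cY XY Z; have := contraction_nucnorm Z cY.
by rewrite trdotDr trdotNr !(trdotC Y); lra.
Qed.

Lemma subgradient_monotone X Y X' Y' : nucnorm_subgradient X Y ->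
  nucnorm_subgradient X' Y' -> 0 <= trdot (X - X') (Y - Y').
Proof.
move=> /(_ X') + /(_ X).
by rewrite !trdot_lin !(trdotC Y) !(trdotC Y'); lra.
Qed.

(** With [X = L S] and [|L|^2 = |S|^2 = <X, Y>], equality in the
    Cauchy-Schwarz inequality [<S, L^T Y> <= |S| |L|] forces [L^T Y = S], and
    likewise [Y S^T = L]; hence [Y X^T Y = (Y S^T) (L^T Y) = L S]. *)
Lemma subgradient_fixed X Y : nucnorm_subgradient X Y -> Y *m X^T *m Y = X.
Proof.
move=> XY; have cY := subgradient_contraction XY.
have [L [S [_ [XE L2 S2 _ _]]]] := nucnorm_decomposition X.
have XYE := subgradient_trdot XY.
have LY : L^T *m Y = S.
  apply/eqP; rewrite -subr_eq0 -fnorm_eq0 -sqrf_eq0 eq_le sqr_ge0 andbT.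
  have : fnorm (L^T *m Y) ^+ 2 <= nucnorm X.
    by rewrite -L2 ler_pXn2r ?nnegrE// -(fnorm_tr L) cY.
  move: XYE; rewrite {1}XE trdot_mull (sqr_fnorm (_ - _)) !trdot_lin.
  by rewrite (trdotC _ S) -!sqr_fnorm S2; lra.
have YS : Y *m S^T = L.
  apply/eqP; rewrite -subr_eq0 -fnorm_eq0 -sqrf_eq0 eq_le sqr_ge0 andbT.
  have : fnorm (Y *m S^T) ^+ 2 <= nucnorm X.
    by rewrite -S2 ler_pXn2r ?nnegrE// -(fnorm_tr S) fnorm_contraction_le.
  move: XYE; rewrite {1}XE trdot_mulr (sqr_fnorm (_ - _)) !trdot_lin.
  by rewrite (trdotC _ L) -!sqr_fnorm L2; lra.
by rewrite XE trmx_mul mulmxA YS -mulmxA LY.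
Qed.

End NuclearNormDuality.

(** * Optimality conditions *)

Section Optimality.
Variables (R : realType) (m n k : nat).
Variable Phi : {linear 'M[R]_(m, n) -> 'cV[R]_k}.
Implicit Types (X Y Z : 'M[R]_(m, n)) (B : 'cV[R]_k) (mu : R).

(** The only candidate for a subgradient of the nuclear norm at a solution:
    minus the gradient of the quadratic term. *)
Definition nucdual B mu X : 'M[R]_(m, n) :=
  - (mu^-1 *: adjoint Phi (Phi X - B)).

Lemma trdot_nucdual B mu X Z :
  trdot (nucdual B mu X) Z = - (mu^-1 * trdot (Phi X - B) (Phi Z)).
Proof. by rewrite trdotNl trdotZl trdotC -adjointP trdotC. Qed.

(** Expanding the square in [nucobj (X + t D)]: the first-order term in [t] is
    governed by the residual. *)
Lemma nucobj_expand B mu X D t : 0 < mu ->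
  nucobj Phi B mu (X + t *: D) = (2 * mu)^-1 * fnorm (Phi X - B) ^+ 2
    - t * trdot (nucdual B mu X) D + t ^+ 2 * ((2 * mu)^-1 * fnorm (Phi D) ^+ 2)
    + nucnorm (X + t *: D).
Proof.
move=> mu0; rewrite /nucobj trdot_nucdual linearD linearZ /= addrAC.
rewrite !sqr_fnorm !(trdotDl, trdotDr) !(trdotZl, trdotZr) (trdotC (Phi D) (Phi X)).
by rewrite (trdotC (Phi D) (- B)); field; rewrite gt_eqF.
Qed.

Lemma nucsol_subgradient B mu X : 0 < mu ->
  nucsol Phi (B, mu) X <-> nucnorm_subgradient X (nucdual B mu X).
Proof.
move=> mu0; split=> [Xopt Z|XY Z]; last first.
  have := nucobj_expand B X (Z - X) 1 mu0; rewrite scale1r subrKC /= => ->.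
  have : 0 <= (2 * mu)^-1 * fnorm (Phi (Z - X)) ^+ 2.
    by rewrite mulr_ge0 ?sqr_ge0// invr_ge0 mulr_ge0// ltW.
  by have := XY Z; rewrite /nucobj; lra.
set Y := nucdual B mu X; set D := Z - X.
set b := (2 * mu)^-1 * fnorm (Phi D) ^+ 2.
have b0 : 0 <= b by rewrite mulr_ge0 ?sqr_ge0// invr_ge0 mulr_ge0// ltW.
rewrite leNgt; apply/negP; rewrite -subr_gt0.
set a := (X in 0 < X) => a0.
(* on [X + t D] the objective decreases by at least [t a - t^2 b] *)
have key t : 0 <= t <= 1 -> t * a <= t ^+ 2 * b.
  move=> /andP[t0 t1]; have := Xopt (X + t *: D).
  rewrite /= nucobj_expand// -/b -/Y.
  have : nucnorm (X + t *: D) <= (1 - t) * nucnorm X + t * nucnorm Z.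
    have -> : X + t *: D = (1 - t) *: X + t *: Z.
      by rewrite scalerBr scalerBl scale1r addrA addrAC.
    rewrite (le_trans (ler_nucnormD _ _))// lerD// ler_nucnormZ// subr_ge0//.
  rewrite /nucobj /a; lra.
have ab : 0 < a + b by lra.
(* a step [t] in (0, 1] for which [t b < a] *)
have := key (a / (2 * (a + b))).
have -> : 0 <= a / (2 * (a + b)) <= 1.
  rewrite divr_ge0 ?ler_pdivrMr ?mulr_gt0//; lra.
move=> /(_ isT); rewrite leNgt => /negP; apply.
rewrite expr2 -mulrA ltr_pM2l ?divr_gt0 ?mulr_gt0//.
rewrite mulrAC ltr_pdivrMr ?mulr_gt0// ltr_pM2l//; lra.
Qed.

End Optimality.

(** * The Frobenius norm and the topology of matrices *)

Section Topology.
Variable R : realType.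

Lemma fnorm_le_mx_norm m n (A : 'M[R]_(m, n)) :
  fnorm A <= (m * n)%:R * `|A|.
Proof.
have entry i j : A i j * A i j <= `|A| ^+ 2.
  rewrite -expr2 -[leLHS]real_normK ?num_real// ler_pXn2r ?nnegrE//.
  rewrite [leRHS]/Num.norm/= mx_normrE; apply/bigmax_geP; right.
  by exists (i, j).
rewrite -(@ler_pXn2r _ 2) ?nnegrE ?mulr_ge0// sqr_fnorm trdotE.
apply: (@le_trans _ _ ((m * n)%:R * `|A| ^+ 2)).
  apply: (@le_trans _ _ (\sum_(i < m) \sum_(j < n) `|A| ^+ 2)).
    by apply: ler_sum => i _; apply: ler_sum => j _; exact: entry.
  by rewrite !sumr_const !card_ord -mulrnA mulnC mulr_natl.
rewrite exprMn ler_wpM2r ?sqr_ge0// -natrX ler_nat -mulnn.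
by case: (m * n)%N => // k; rewrite leq_pmulr.
Qed.

Lemma mx_norm_le_fnorm m n (A : 'M[R]_(m, n)) : `|A| <= fnorm A.
Proof.
rewrite [leLHS]/Num.norm/= mx_normrE; apply: bigmax_le => // i _.
exact: ler_entry_fnorm.
Qed.

Lemma nbhs_fnorm m n (A : 'M[R]_(m, n)) e : 0 < e ->
  nbhs A [set A' | fnorm (A' - A) < e].
Proof.
move=> e0; apply/nbhs_ballP; exists (e / ((m * n)%:R + 1)) => /=.
  by rewrite divr_gt0// ltr_wpDl.
move=> A'; rewrite mx_norm_ball /ball_ /= distrC ltr_pdivlMr ?ltr_wpDl// => AA'.
rewrite (le_lt_trans (fnorm_le_mx_norm _))// (le_lt_trans _ AA')//.
by rewrite mulrC ler_wpM2l// lerDl.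
Qed.

Lemma lipschitz_fnorm_continuous m n (h : 'M[R]_(m, n) -> R) K :
  (forall A A', h A' - h A <= K * fnorm (A' - A)) -> continuous h.
Proof.
move=> hK A; apply/(@cvgrPdist_lt _ _ _ (nbhs A) (nbhs_filter A)) => e e0.
have K1 : 0 < `|K| + 1 by rewrite ltr_wpDl.
near=> A'.
have : fnorm (A' - A) < e / (`|K| + 1).
  by near: A'; exact: nbhs_fnorm (divr_gt0 e0 K1).
rewrite ltr_pdivlMr// => AA'; apply: le_lt_trans AA'.
have KK : K * fnorm (A' - A) <= fnorm (A' - A) * (`|K| + 1).
  by rewrite mulrC ler_wpM2l// (le_trans (ler_norm K))// lerDl.
have := hK A A'; have := hK A' A; rewrite -(fnormN (A - A')) opprB.
by rewrite ler_norml; lra.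
Unshelve. all: by end_near. Qed.

End Topology.

(** * Existence of solutions *)

Section Existence.
Variables (R : realType) (m n k : nat).
Variable Phi : {linear 'M[R]_(m, n) -> 'cV[R]_k}.

(** The objective is continuous and bounds the nuclear norm, hence is
    coercive: minimize it over a ball. *)
Lemma nucsol_exists B mu : 0 < mu -> exists X, nucsol Phi (B, mu) X.
Proof.
move=> mu0; pose f := nucobj Phi B mu.
have mu2 : 0 <= (2 * mu)^-1 by rewrite invr_ge0 mulr_ge0// ltW.
have ff X : fnorm X <= f X.
  rewrite (le_trans (fnorm_le_nucnorm X))// lerDr.
  by rewrite mulr_ge0// sqr_ge0.
have [K K0 hK] := linear_fnorm_bounded Phi.
pose g (v : 'rV[R]_(m * n)) := f (vec_mx v).
have fnorm_sub p q (M N : 'M[R]_(p, q)) : fnorm N - fnorm M <= fnorm (N - M).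
  by rewrite lerBlDr (le_trans _ (ler_fnormD _ _))// subrK.
have [K' K'0 hK'] := linear_fnorm_bounded (@vec_mx R m n).
have c1 : continuous (fun v : 'rV[R]_(m * n) => fnorm (vec_mx v)).
  apply: (@lipschitz_fnorm_continuous _ _ _ _ K') => v w.
  by rewrite (le_trans (fnorm_sub _ _ _ _))// -linearB hK'.
have c2 : continuous (fun v : 'rV[R]_(m * n) => fnorm (Phi (vec_mx v) - B)).
  apply: (@lipschitz_fnorm_continuous _ _ _ _ (K * K')) => v w.
  rewrite (le_trans (fnorm_sub _ _ _ _))// opprB addrA subrK -!linearB.
  by rewrite (le_trans (hK _))// -mulrA ler_wpM2l.
have c3 : continuous (fun v : 'rV[R]_(m * n) => nucnorm (vec_mx v)).
  pose c := fnorm (1%:M : 'M[R]_m).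
  apply: (@lipschitz_fnorm_continuous _ _ _ _ (c * K')) => v w.
  apply: (@le_trans _ _ (nucnorm (vec_mx (w - v)))).
    by rewrite lerBlDr (le_trans _ (ler_nucnormD _ _))// -linearD subrK.
  by rewrite (le_trans (nucnorm_le_fnorm _))// -mulrA ler_wpM2l ?fnorm_ge0 ?hK'.
have cg : continuous g.
  rewrite (_ : g = fun v => (2 * mu)^-1 * (fnorm (Phi (vec_mx v) - B) *
      fnorm (Phi (vec_mx v) - B)) + nucnorm (vec_mx v)); last first.
    by apply/funext => v; rewrite -expr2.
  move=> v; have Fv := nbhs_filter v.
  have c4 := cvgM (cvg_cst (2 * mu)^-1) (cvgM (c2 v) (c2 v)).
  by have c5 := cvgD (c4 Fv Fv Fv) (c3 v); refine (c5 _).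
pose A := [set v : 'rV[R]_(m * n) | fnorm (vec_mx v) <= f 0].
have Ac : compact A.
  apply: bounded_closed_compact.
    have [K'' _ hK''] := linear_fnorm_bounded (@mxvec R m n).
    exists (`|K''| * f 0); split; first exact: num_real.
    move=> M ltM v /= Av; rewrite (le_trans (mx_norm_le_fnorm _))//.
    rewrite (le_trans _ (ltW ltM))// -(vec_mxK v) (le_trans (hK'' _))//.
    by rewrite (le_trans (ler_wpM2r _ (ler_norm _)))// ler_wpM2l.
  have := @preimage_closed _ _ _ [set r | r <= f 0] (fun v _ => c1 v).
  by move=> /(_ (@closed_le R (f 0))).
have A0 : A !=set0.
  by exists 0; rewrite /A/= linear0 ff.
have [v vA vmin] := compact_EVT_min A0 Ac (continuous_subspaceT cg).
exists (vec_mx v) => X.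
have [XA|XA] := leP (fnorm X) (f 0).
  by have := vmin (mxvec X); rewrite /g mxvecK; apply; rewrite inE /A/= mxvecK.
rewrite (le_trans _ (ff X))// (le_trans _ (ltW XA))//.
by have := vmin 0; rewrite /g linear0; apply; rewrite inE /A/= linear0 ff.
Qed.

End Existence.

(** * Fixed points of the dual matrix and symmetric blocks *)

Section BlockStructure.
Variables (R : realType) (n1 n2 : nat) (hn : (n1 <= n2)%N).

Lemma card_initial_segment n (P : pred 'I_n) :
  (forall i j : 'I_n, (i <= j)%N -> P j -> P i) -> forall i, P i = (i < #|P|)%N.
Proof.
move=> Pdown i.
have card_lt k : (k <= n)%N -> #|[pred j : 'I_n | (j < k)%N]| = k.
  by move=> kn; rewrite -sum1_card (big_ord_narrow kn) sum1_card card_ord.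
have [Pi|nPi] := boolP (P i); apply/esym.
  rewrite -[X in (X <= _)%N](card_lt i.+1 (ltn_ord i)).
  by apply: subset_leq_card; apply/fintype.subsetP => j; rewrite !inE ltnS => /Pdown; apply.
apply/negbTE; rewrite -leqNgt -[X in (_ <= X)%N](card_lt i (ltnW (ltn_ord i))).
apply: subset_leq_card; apply/fintype.subsetP => j Pj; rewrite inE ltnNge.
by apply: contra nPi => /Pdown; apply.
Qed.

Variables (Y : 'M[R]_(n1, n2)) (U : 'M[R]_n1) (V : 'M[R]_n2).
Hypotheses (UV : osvd Y (U, V)) (cY : mx_contraction Y).
Let D := singvals_mx Y.
Let p := num_singvals1 Y.

Lemma osvd_middle : U^T *m Y *m V = D.
Proof.
have [/= Uo Vo YE] := UV.
by rewrite {1}YE !mulmxA Uo mul1mx -mulmxA Vo mulmx1.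
Qed.

Lemma singvals_mx_contraction : mx_contraction D.
Proof.
have [/= Uo Vo _] := UV; rewrite -osvd_middle.
apply: contractionM; last exact: orthogonal_contraction.
by apply: contractionM => //; apply: contraction_tr; exact: orthogonal_contraction.
Qed.

Lemma singvals_le1 i : singvals Y 0 i <= 1.
Proof.
have := ler_entry_fnorm (delta_mx (0 : 'I_1) i *m D) 0 (widen_ord hn i).
rewrite -{1}rowE !mxE eqxx => /(le_trans (ler_norm _)) /le_trans; apply.
rewrite (le_trans (singvals_mx_contraction _))// -sqrtr1 ler_sqrt ?ler01//.
rewrite trdotE big_ord1 (bigD1 i)//= big1 => [|j ji].
  by rewrite !mxE !eqxx mulr1 addr0.
by rewrite mxE (negPf ji) andbF mulr0.
Qed.

Lemma singvals_eq1 i : (singvals Y 0 i == 1) = (i < p)%N.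
Proof.
have [_ sdec _] := singvalsP Y.
rewrite /p /num_singvals1 -(card_initial_segment (P := [pred i | singvals Y 0 i == 1]))//=.
move=> {}i j ij /eqP sj; rewrite eq_le singvals_le1 /= -sj.
exact: sdec.
Qed.

Lemma p_le_n1 : (p <= n1)%N.
Proof. by rewrite -[leqRHS]card_ord max_card. Qed.

Lemma pid_singvals_mx : pid_mx p *m D = pid_mx p :> 'M[R]_(p, n2).
Proof.
apply/matrixP => i j; rewrite !mxE (bigD1 (widen_ord p_le_n1 i))//= big1 => [|k ki].
  rewrite !mxE /= eqxx ltn_ord mul1r addr0.
  have /eqP -> : singvals Y 0 (widen_ord p_le_n1 i) == 1.
    by rewrite singvals_eq1 /= ltn_ord.
  by rewrite andbT; case: eqP.
rewrite !mxE; case: eqP => [ik|]; last by rewrite mul0r.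
by case/eqP: ki; apply: val_inj; rewrite /= ik.
Qed.

Lemma singvals_mx_pid : D *m pid_mx p = pid_mx p :> 'M[R]_(n1, p).
Proof.
apply/matrixP => j i.
rewrite !mxE (bigD1 (widen_ord hn (widen_ord p_le_n1 i)))//= big1 => [|k ki].
  rewrite !mxE /= eqxx ltn_ord mulr1 addr0.
  case: eqP => [ji|//] /=.
  have -> : (j < p)%N by rewrite ji ltn_ord.
  by apply/eqP; rewrite singvals_eq1 ji ltn_ord.
rewrite !mxE; have [ik|_] := eqVneq (k : nat) i; last by rewrite mulr0.
by case/eqP: ki; apply: val_inj; rewrite /= ik.
Qed.

(** In the coordinates of the decomposition the equation reads
    [H = D H^T D], so [H = (D D^T) H (D^T D)].  A row of index [i >= p] is thus
    multiplied by [s_i^2 < 1] and by a contraction, and vanishes; the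
    remaining block satisfies [H = H^T] because [D] is the identity there. *)
Lemma fixed_sym_block H : Y *m H^T *m Y = H -> sym_block p U V H.
Proof.
have [/= Uo Vo _] := UV => YHY.
have UUt : U *m U^T = 1%:M by apply: mulmx1C.
have VVt : V *m V^T = 1%:M by apply: mulmx1C.
pose G := U^T *m H *m V.
have GE : D *m G^T *m D = G.
  rewrite -osvd_middle /G !trmx_mul trmxK !mulmxA -(mulmxA _ V V^T) VVt mulmx1.
  by rewrite -(mulmxA _ U U^T) UUt mulmx1 -!(mulmxA U^T) YHY.
have HE : H = U *m G *m V^T.
  by rewrite /G !mulmxA UUt mul1mx -mulmxA VVt mulmx1.
clearbody G.
have cD := singvals_mx_contraction.
have G2 : D *m D^T *m G *m D^T *m D = G.
  have GT : G^T = D^T *m G *m D^T by rewrite -{1}GE !trmx_mul trmxK mulmxA.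
  by rewrite -[RHS]GE GT !mulmxA.
have rowG (i : 'I_n1) : (p <= i)%N -> row i G = 0.
  move=> ip; have si1 : singvals Y 0 i < 1.
    by rewrite lt_neqAle singvals_le1 singvals_eq1 -leqNgt ip.
  have si0 : 0 <= singvals Y 0 i by have [] := singvalsP Y.
  have DDi : row i (D *m D^T) = singvals Y 0 i ^+ 2 *: delta_mx 0 i.
    apply/rowP => j; rewrite !mxE (bigD1 (widen_ord hn i))//= big1 => [|k ki].
      rewrite !mxE /= eqxx addr0 (eq_sym (j : nat)).
      have [ij|ij] := eqVneq i j; first by rewrite ij eqxx mulr1.
      by rewrite (_ : (_ == _ :> nat) = false) ?mulr0 ?mulr0//; apply/negbTE.
    rewrite !mxE; case: eqP => [ik|]; last by rewrite mul0r.
    by case/eqP: ki; apply: val_inj.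
  have : fnorm (row i G) <= singvals Y 0 i ^+ 2 * fnorm (row i G).
    rewrite -{1}G2 !row_mul -row_mul DDi -!scalemxAl -rowE fnormZ.
    rewrite ger0_norm ?sqr_ge0// ler_wpM2l ?sqr_ge0//.
    by rewrite (le_trans (cD _ _))// (contraction_tr cD).
  have := fnorm_ge0 (row i G); move=> r0 rle; apply/eqP.
  rewrite -fnorm_eq0 eq_le r0 andbT.
  have : singvals Y 0 i ^+ 2 < 1 by rewrite expr_lt1.
  nra.
have pG : (pid_mx p : 'M[R]_n1) *m G = G.
  apply/row_matrixP => i; rewrite row_mul.
  have -> : row i (pid_mx p : 'M[R]_n1) = (i < p)%:R *: delta_mx 0 i.
    by apply/rowP => j; rewrite !mxE eqxx (eq_sym j) -natrM mulnb andbC.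
  rewrite -scalemxAl -rowE; have [_|/rowG ->] := ltnP; first by rewrite scale1r.
  by rewrite scaler0.
have pp m k l : (pid_mx p : 'M[R]_(m, p)) *m (pid_mx p : 'M_(p, k)) *m
    (pid_mx p : 'M_(k, l)) = (pid_mx p : 'M_(m, k)) *m (pid_mx p : 'M_(k, l)).
  by rewrite mul_pid_mx !minnn.
have pp2 m k : (pid_mx p : 'M[R]_(m, p)) *m (pid_mx p : 'M_(p, k)) = pid_mx p.
  by rewrite mul_pid_mx !minnn.
have pD : (pid_mx p : 'M[R]_n1) *m D = pid_mx p.
  by rewrite -(pp2 n1 n1) -mulmxA pid_singvals_mx pp2.
have Gp : G *m (pid_mx p : 'M[R]_n2) = G.
  have -> : G = D *m G^T *m (pid_mx p : 'M[R]_(n1, n2)).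
    by rewrite -pD -{1}GE -{1}pG trmx_mul tr_pid_mx !mulmxA.
  rewrite -[in LHS]mulmxA pid_mx_id//.
  exact: leq_trans p_le_n1 hn.
exists (pid_mx p *m G *m pid_mx p); last first.
  by rewrite HE; congr (_ *m _ *m _); rewrite !mulmxA pp2 pG -mulmxA pp2.
rewrite /= !trmx_mul !tr_pid_mx mulmxA -[in RHS]GE.
by rewrite !mulmxA pid_singvals_mx -[in RHS]mulmxA singvals_mx_pid.
Qed.

End BlockStructure.

(** * Comparing the solutions at two parameters *)

Section Multipliers.
Variables (R : realType) (m n k : nat).
Variable Phi : {linear 'M[R]_(m, n) -> 'cV[R]_k}.

Lemma fnorm_adjoint_le K z : 0 <= K ->
  (forall X, fnorm (Phi X) <= K * fnorm X) ->
  fnorm (adjoint Phi z) <= K * fnorm z.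
Proof.
move=> K0 hK; set a := fnorm (adjoint _ _).
have [->|a0] := eqVneq a 0; first by rewrite mulr_ge0.
have a_gt0 : 0 < a by rewrite lt0r a0 fnorm_ge0.
rewrite -(ler_pM2l a_gt0) -expr2 sqr_fnorm -adjointP.
by rewrite (le_trans (trdot_le _ _))// mulrA (mulrC a) ler_wpM2r.
Qed.

Lemma adjointB z z' : adjoint Phi (z - z') = adjoint Phi z - adjoint Phi z'.
Proof. by apply/matrixP => i j; rewrite !mxE trdotDr trdotNr. Qed.

Lemma nucdualE B mu X : mu != 0 ->
  mu *: nucdual Phi B mu X = adjoint Phi (B - Phi X).
Proof.
move=> mu0; rewrite scalerN scalerA divff// scale1r.
by apply/matrixP => i j; rewrite !mxE -trdotNr opprB.
Qed.

Lemma nucdual_diff B B' mu mu' X X' : mu != 0 -> mu' != 0 ->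
  mu *: (nucdual Phi B mu X - nucdual Phi B' mu' X') =
  adjoint Phi ((B - B') - Phi (X - X')) - (mu - mu') *: nucdual Phi B' mu' X'.
Proof.
move=> mu0 mu'0.
have -> : B - B' - Phi (X - X') = (B - Phi X) - (B' - Phi X').
  by rewrite linearB !opprB [Phi X' - _]addrC addrACA [- B' + _]addrC.
by rewrite adjointB -(nucdualE B X mu0) -(nucdualE B' X' mu'0) scalerBr scalerBl opprB addrA subrK.
Qed.

Lemma nucsol_fnorm_le B mu X : 0 < mu -> nucsol Phi (B, mu) X ->
  fnorm X <= (2 * mu)^-1 * fnorm B ^+ 2.
Proof.
move=> mu0 /(_ 0) /=; rewrite /nucobj linear0 sub0r fnormN nucnorm0 addr0.
apply: le_trans; rewrite (le_trans (fnorm_le_nucnorm X))// lerDr.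
by rewrite mulr_ge0 ?sqr_ge0// invr_ge0 mulr_ge0// ltW.
Qed.

End Multipliers.

Section JointMap.
Variables (R : realType) (m n k : nat).
Variable Phi : {linear 'M[R]_(m, n) -> 'cV[R]_k}.
Variable Y : 'M[R]_(m, n).

(** The pair [(Phi H, H - Y H^T Y)], flattened into one row vector so that a
    single linear left inverse serves both components. *)
Definition joint_map (H : 'M[R]_(m, n)) : 'rV[R]_(k * 1 + m * n) :=
  mxvec (Phi H) *m row_mx 1%:M 0 + mxvec (H - Y *m H^T *m Y) *m row_mx 0 1%:M.

Lemma joint_map_is_linear : linear joint_map.
Proof.
move=> a u v; rewrite /joint_map.
have -> : a *: u + v - Y *m (a *: u + v)^T *m Y =
    a *: (u - Y *m u^T *m Y) + (v - Y *m v^T *m Y).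
  rewrite linearP /= mulmxDr mulmxDl -scalemxAr -scalemxAl.
  by rewrite scalerBr opprD addrACA.
by rewrite !linearP /= !mulmxDl -!scalemxAl addrACA scalerDr.
Qed.

HB.instance Definition _ := GRing.isLinear.Build R 'M[R]_(m, n)
  'rV[R]_(k * 1 + m * n) *:%R joint_map joint_map_is_linear.

(** The two hypotheses on [H] say that [joint_map H = 0], so [joint_map] has a
    bounded left inverse. *)
Lemma joint_injective_bounded :
  (forall H, Phi H = 0 -> Y *m H^T *m Y = H -> H = 0) ->
  exists2 K, 0 <= K &
    forall H, fnorm H <= K * (fnorm (Phi H) + fnorm (H - Y *m H^T *m Y)).
Proof.
move=> inj; have [|K K0 hK] := @injective_fnorm_bounded _ _ _ _ _ joint_map.
  move=> H /=; rewrite /joint_map !mul_mx_row !mulmx1 !mulmx0 add_row_mx addr0 add0r.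
  rewrite -row_mx0 => /eq_row_mx[/eqP + /eqP].
  by rewrite !mxvec_eq0 subr_eq0 => /eqP PH /eqP YH; apply: inj.
have [K1 K10 hK1] := linear_fnorm_bounded (@mxvec R k 1).
have [K2 K20 hK2] := linear_fnorm_bounded (@mxvec R m n).
pose c1 := fnorm (row_mx 1%:M 0 : 'M[R]_(k * 1, k * 1 + m * n)).
pose c2 := fnorm (row_mx 0 1%:M : 'M[R]_(m * n, k * 1 + m * n)).
have c10 : 0 <= c1 by exact: fnorm_ge0.
have c20 : 0 <= c2 by exact: fnorm_ge0.
exists (K * (K1 * c1 + K2 * c2)); first by rewrite mulr_ge0// addr_ge0// mulr_ge0.
move=> H; rewrite (le_trans (hK H))// -mulrA ler_wpM2l//.
rewrite (le_trans (ler_fnormD _ _))//.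
have H1 := fnormM (mxvec (Phi H)) (row_mx 1%:M 0 : 'M[R]_(k * 1, k * 1 + m * n)).
have H2 := fnormM (mxvec (H - Y *m H^T *m Y)) (row_mx 0 1%:M : 'M[R]_(m * n, k * 1 + m * n)).
rewrite -/c1 in H1; rewrite -/c2 in H2.
rewrite (le_trans (lerD H1 H2))//.
have G1 := ler_wpM2r c10 (hK1 (Phi H)).
have G2 := ler_wpM2r c20 (hK2 (H - Y *m H^T *m Y)).
rewrite (le_trans (lerD G1 G2))//.
have := fnorm_ge0 (Phi H); have := fnorm_ge0 (H - Y *m H^T *m Y).
move: (fnorm _) (fnorm _) => a b a0 b0.
have := mulr_ge0 (mulr_ge0 K10 c10) a0; have := mulr_ge0 (mulr_ge0 K20 c20) b0.
by lra.
Qed.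

End JointMap.

Section PairEstimates.
Variables (R : realType) (m n k : nat).
Variable Phi : {linear 'M[R]_(m, n) -> 'cV[R]_k}.
Variable K : R.
Hypotheses (K0 : 0 <= K) (hK : forall X, fnorm (Phi X) <= K * fnorm X).
Let N := fnorm (1%:M : 'M[R]_m).

Lemma contraction_fnorm_le (Y : 'M[R]_(m, n)) : mx_contraction Y -> fnorm Y <= N.
Proof. by move=> cY; rewrite -[Y]mul1mx. Qed.

Variables (B B' : 'cV[R]_k) (mu mu' : R) (X X' : 'M[R]_(m, n)).
Hypotheses (mu0 : 0 < mu) (mu'0 : 0 < mu').
Hypotheses (SX : nucsol Phi (B, mu) X) (SX' : nucsol Phi (B', mu') X').
Let Y := nucdual Phi B mu X.
Let Y' := nucdual Phi B' mu' X'.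
Let d := fnorm (B - B') + `|mu - mu'|.

Let XY : nucnorm_subgradient X Y.
Proof. exact/nucsol_subgradient. Qed.

Let XY' : nucnorm_subgradient X' Y'.
Proof. exact/nucsol_subgradient. Qed.

Let N0 : 0 <= N. Proof. exact: fnorm_ge0. Qed.

Let YN : fnorm Y <= N.
Proof. exact/contraction_fnorm_le/(subgradient_contraction XY). Qed.

Let Y'N : fnorm Y' <= N.
Proof. exact/contraction_fnorm_le/(subgradient_contraction XY'). Qed.

(** Monotonicity of the subdifferential: [Y - Y'] is [- Phi^* Phi (X - X') / mu]
    up to the size of the change of data. *)
Lemma sqr_fnorm_image_diff_le :
  fnorm (Phi (X - X')) ^+ 2 <= fnorm (X - X') * ((K + N) * d).
Proof.
have := subgradient_monotone XY XY'; rewrite -(pmulr_rge0 _ mu0) -trdotZr.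
rewrite nucdual_diff ?gt_eqF// trdotDr trdotNr trdotZr -adjointP trdotDr trdotNr.
rewrite -/Y' -sqr_fnorm => mon.
have h1 : trdot (Phi (X - X')) (B - B') <= K * fnorm (X - X') * fnorm (B - B').
  by rewrite (le_trans (trdot_le _ _))// ler_wpM2r.
have h2 : - ((mu - mu') * trdot (X - X') Y') <= `|mu - mu'| * (fnorm (X - X') * N).
  rewrite (le_trans (ler_norm _))// normrN normrM ler_wpM2l//.
  rewrite (@le_trans _ _ (fnorm (X - X') * fnorm Y'))// ?ler_wpM2l//.
  by rewrite ler_norml trdot_le trdot_ge.
have x0 := fnorm_ge0 (X - X').
have h3 := mulr_ge0 x0 (mulr_ge0 K0 (normr_ge0 (mu - mu'))).
have h4 := mulr_ge0 x0 (mulr_ge0 N0 (fnorm_ge0 (B - B'))).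
rewrite /d; nra.
Qed.

Lemma nucdual_diff_le : mu * fnorm (Y - Y') <= (K + N) * d + K * fnorm (Phi (X - X')).
Proof.
rewrite -[X in X * _](gtr0_norm mu0) -fnormZ nucdual_diff ?gt_eqF//.
have h1 := ler_fnormB (adjoint Phi (B - B' - Phi (X - X'))) ((mu - mu') *: Y').
have h2 := fnorm_adjoint_le (B - B' - Phi (X - X')) K0 hK.
have h3 := ler_wpM2l K0 (ler_fnormB (B - B') (Phi (X - X'))).
have h4 := ler_wpM2l (normr_ge0 (mu - mu')) Y'N; rewrite -fnormZ in h4.
have h5 := mulr_ge0 K0 (normr_ge0 (mu - mu')).
have h6 := mulr_ge0 N0 (fnorm_ge0 (B - B')).
by rewrite (le_trans h1)// /d; lra.
Qed.

(** The equation [X = Y X^T Y] passes to differences up to a multiple of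
    [Y - Y'], with [Y] then replaced by a nearby contraction [Z]. *)
Lemma fixed_diff_le (Z : 'M[R]_(m, n)) : mx_contraction Z ->
  fnorm ((X - X') - Z *m (X - X')^T *m Z) <=
    2 * N * (fnorm X' * fnorm (Y - Y') + fnorm (Y - Z) * fnorm (X - X')).
Proof.
move=> /contraction_fnorm_le ZN.
have bil (A C H : 'M[R]_(m, n)) : fnorm A <= N -> fnorm C <= N ->
    fnorm (A *m H^T *m A - C *m H^T *m C) <= 2 * N * (fnorm (A - C) * fnorm H).
  move=> AN CN.
  have -> : A *m H^T *m A - C *m H^T *m C =
      (A - C) *m H^T *m A + C *m H^T *m (A - C).
    by rewrite mulmxBr !mulmxBl addrA subrK.
  have h1 : fnorm ((A - C) *m H^T *m A) <= fnorm (A - C) * fnorm H * N.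
    rewrite (le_trans (fnormM _ _))// ler_pM// -(fnorm_tr H); exact: fnormM.
  have h2 : fnorm (C *m H^T *m (A - C)) <= N * fnorm H * fnorm (A - C).
    rewrite (le_trans (fnormM _ _))// ler_wpM2r// (le_trans (fnormM _ _))//.
    by rewrite fnorm_tr ler_wpM2r.
  by rewrite (le_trans (ler_fnormD _ _))//; lra.
have -> : X - X' - Z *m (X - X')^T *m Z = (Y *m X'^T *m Y - Y' *m X'^T *m Y') +
    (Y *m (X - X')^T *m Y - Z *m (X - X')^T *m Z).
  rewrite (subgradient_fixed XY') addrA; congr (_ - _).
  rewrite [in RHS]linearB /= mulmxBr mulmxBl (subgradient_fixed XY).
  by rewrite [RHS]addrC addrA subrK.
have h1 := bil _ _ X' YN Y'N; have h2 := bil _ _ (X - X') YN ZN.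
by rewrite (le_trans (ler_fnormD _ _))//; lra.
Qed.

End PairEstimates.

(** * Lipschitz stability *)

(** By the inequality of arithmetic and geometric means,
    [2 alpha a <= x + alpha^2 gamma d]. *)
Lemma quadratic_bound (R : realType) (x a d alpha beta gamma : R) :
  0 <= x -> 0 <= d -> 0 <= gamma ->
  x <= alpha * a + beta * d -> a ^+ 2 <= x * (gamma * d) ->
  x <= (2 * beta + alpha ^+ 2 * gamma) * d.
Proof.
move=> x0 d0 g0 xle ale.
have e0 : 0 <= alpha ^+ 2 * gamma * d by rewrite mulr_ge0// mulr_ge0// sqr_ge0.
have aa : (alpha * a) ^+ 2 <= x * (alpha ^+ 2 * gamma * d).
  rewrite exprMn (le_trans (ler_wpM2l (sqr_ge0 alpha) ale))//.
  by rewrite le_eqVlt; apply/orP; left; apply/eqP; ring.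
have : 2 * (alpha * a) <= x + alpha ^+ 2 * gamma * d.
  rewrite leNgt; apply/negP => lt.
  have : (x + alpha ^+ 2 * gamma * d) ^+ 2 < (2 * (alpha * a)) ^+ 2.
    by rewrite ltr_pXn2r ?nnegrE ?addr_ge0// ltW// (le_lt_trans _ lt)// addr_ge0.
  have := sqr_ge0 (x - alpha ^+ 2 * gamma * d); move: aa.
  by move: (alpha ^+ 2 * gamma * d) (alpha * a) => e b; nra.
by lra.
Qed.

Definition param_box (R : realType) (k : nat) (q0 : 'cV[R]_k * R) (delta : R) :
    set ('cV[R]_k * R) :=
  [set q | fnorm (q.1 - q0.1) < delta /\ `|q.2 - q0.2| < delta].

Section Stability.
Variables (R : realType) (m n k : nat).
Variable Phi : {linear 'M[R]_(m, n) -> 'cV[R]_k}.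
Variables (Bb : 'cV[R]_k) (mub : R) (Xb : 'M[R]_(m, n)).
Hypotheses (mub0 : 0 < mub) (SXb : nucsol Phi (Bb, mub) Xb).
Let Yb := nucdual Phi Bb mub Xb.

Local Notation box := (param_box (Bb, mub)).

Lemma box_mu delta q : delta <= mub / 2 -> box delta q -> mub / 2 <= q.2.
Proof. by move=> dm [_]; rewrite ltr_norml /= => /andP[+ _]; lra. Qed.

Lemma box_nucsol_bounded delta q X : delta <= 1 -> delta <= mub / 2 ->
  box delta q -> nucsol Phi q X -> fnorm X <= (fnorm Bb + 1) ^+ 2 / mub.
Proof.
case: q => B mu d1 dm Bq SX; have /= mule := box_mu dm Bq.
have mu0 : 0 < mu by rewrite (lt_le_trans _ mule)// divr_gt0.
rewrite (le_trans (nucsol_fnorm_le mu0 SX))// mulrC ler_pM ?sqr_ge0//.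
- by rewrite invr_ge0 mulr_ge0// ltW.
- rewrite ler_pXn2r ?nnegrE ?addr_ge0//.
  have := ler_fnormD (B - Bb) Bb; rewrite subrK => /le_trans; apply.
  by have [/= Bd _] := Bq; lra.
- by rewrite lef_pV2 ?posrE ?mulr_gt0//; lra.
Qed.

(** Since the solutions near [(Bb, mub)] are bounded, monotonicity alone keeps
    their dual matrices close to [Yb]. *)
Lemma nucdual_continuous eta : 0 < eta ->
  exists delta, [/\ 0 < delta, delta <= 1, delta <= mub / 2 &
    forall q X, box delta q -> nucsol Phi q X ->
      fnorm (nucdual Phi q.1 q.2 X - Yb) <= eta].
Proof.
move=> eta0; have [K K0 hK] := linear_fnorm_bounded Phi.
pose N := fnorm (1%:M : 'M[R]_m); have N0 : 0 <= N := fnorm_ge0 _.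
pose rho := (fnorm Bb + 1) ^+ 2 / mub.
have rho0 : 0 <= rho by rewrite divr_ge0 ?sqr_ge0// ltW.
pose t := mub / 2 * eta / 2; have t0 : 0 < t by rewrite divr_gt0// mulr_gt0// divr_gt0.
have tE : t + t = mub / 2 * eta by rewrite /t; field.
clearbody t.
pose g := K + N; have g0 : 0 <= g by rewrite addr_ge0.
pose w := 4 * K ^+ 2 * rho * g.
have w0 : 0 <= w by rewrite mulr_ge0// mulr_ge0// mulr_ge0// sqr_ge0.
(* With [d <= 2 delta] the distance of the parameters, [nucdual_diff_le] leaves
   two terms [g d] and [K |Phi (X - Xb)|], whose square is at most [w delta];
   each is made smaller than [t]. *)
exists (Num.min (Num.min 1 (mub / 2))
                (Num.min (t / (2 * g + 1)) (t ^+ 2 / (w + 1)))).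
set delta := Num.min _ _.
have [[d1 dm] [dt dw]] : (delta <= 1 /\ delta <= mub / 2) /\
    (delta <= t / (2 * g + 1) /\ delta <= t ^+ 2 / (w + 1)).
  by rewrite /delta !ge_min !lexx !orbT.
have delta0 : 0 < delta.
  have g1 : 0 < 2 * g + 1 by rewrite ltr_wpDl// mulr_ge0.
  have w1 : 0 < w + 1 by rewrite ltr_wpDl.
  by rewrite !lt_min ltr01 !divr_gt0// exprn_gt0.
split=> // -[B mu] X Bq SX.
have /= mule := box_mu dm Bq.
have Bb0 : box delta (Bb, mub) by rewrite /param_box /= !subrr fnorm0 normr0.
have mu0 : 0 < mu by rewrite (lt_le_trans _ mule)// divr_gt0.
have Xr := box_nucsol_bounded d1 dm Bq SX.
have Xbr := box_nucsol_bounded d1 dm Bb0 SXb.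
have x_le : fnorm (X - Xb) <= 2 * rho.
  by rewrite (le_trans (ler_fnormB _ _))// /rho; lra.
have [/= Bd md] := Bq.
have h1 := sqr_fnorm_image_diff_le K0 hK mu0 mub0 SX SXb.
have h2 := nucdual_diff_le K0 hK B X mu0 mub0 SXb.
rewrite -/N -/g in h1 h2; rewrite -/Yb in h2.
have d_le : fnorm (B - Bb) + `|mu - mub| <= 2 * delta by lra.
move: (fnorm (B - Bb) + _) d_le (addr_ge0 (fnorm_ge0 (B - Bb)) (normr_ge0 (mu - mub))) h1 h2.
move=> d d_le d0 h1 h2.
have gd : g * d <= t.
  rewrite (le_trans (ler_wpM2l g0 d_le))//.
  move: dt; rewrite ler_pdivlMr ?ltr_wpDl ?mulr_ge0//; lra.
have Ka : K * fnorm (Phi (X - Xb)) <= t.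
  rewrite -(@ler_pXn2r _ 2) ?nnegrE ?mulr_ge0// ?(ltW t0)//.
  rewrite exprMn (le_trans (ler_wpM2l (sqr_ge0 K) h1))//.
  have h3 : fnorm (X - Xb) * (g * d) <= 2 * rho * (g * (2 * delta)).
    by rewrite ler_pM ?mulr_ge0// ler_wpM2l.
  rewrite (le_trans (ler_wpM2l (sqr_ge0 K) h3))//.
  rewrite (_ : K ^+ 2 * _ = w * delta); last by rewrite /w; ring.
  by move: dw; rewrite ler_pdivlMr ?ltr_wpDl//; lra.
have h4 : mub / 2 * fnorm (nucdual Phi B mu X - Yb) <= mub / 2 * eta.
  rewrite (le_trans (ler_wpM2r (fnorm_ge0 _) mule))// (le_trans h2)//.
  by rewrite -tE lerD.
by move: h4; rewrite ler_pM2l// divr_gt0.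
Qed.

Hypothesis inj : forall H, Phi H = 0 -> Yb *m H^T *m Yb = H -> H = 0.

(** The image difference [Phi (X - X')] is controlled by the square root of
    [|X - X'|] times the change of data, and [X - X'] by [Phi (X - X')] plus
    the change of data; [quadratic_bound] resolves the two. *)
Lemma nucsol_lipschitz : exists delta, exists L,
  [/\ 0 < delta, delta <= mub / 2 & forall q q' X X',
    box delta q -> box delta q' -> nucsol Phi q X -> nucsol Phi q' X' ->
    fnorm (X - X') <= L * (fnorm (q.1 - q'.1) + `|q.2 - q'.2|)].
Proof.
have [K K0 hK] := linear_fnorm_bounded Phi.
have [K1 K10 hK1] := joint_injective_bounded inj.
pose N := fnorm (1%:M : 'M[R]_m); have N0 : 0 <= N := fnorm_ge0 _.
pose rho := (fnorm Bb + 1) ^+ 2 / mub.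
have rho0 : 0 <= rho by rewrite divr_ge0 ?sqr_ge0// ltW.
pose g := K + N; have g0 : 0 <= g by rewrite addr_ge0.
pose c := mub / 2; have c0 : 0 < c by rewrite divr_gt0.
have NK0 : 0 <= 4 * N * K1 by rewrite !mulr_ge0.
(* dual matrices this close to [Yb] let the term in [|Y - Yb| |X - X'|] be
   absorbed: it is at most [|X - X'| / 2] *)
have eta0 : 0 < (4 * N * K1 + 1)^-1 by rewrite invr_gt0 ltr_wpDl.
have [delta [d0 d1 dm Yclose]] := nucdual_continuous eta0.
pose s := 4 * K1 * N * rho / c.
have s0 : 0 <= s by rewrite divr_ge0 ?(ltW c0)// mulr_ge0// mulr_ge0// mulr_ge0.
exists delta, (2 * (s * g) + (2 * K1 + s * K) ^+ 2 * g); split => //.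
move=> [B mu] [B' mu'] X X' Bq Bq' SX SX' /=.
have /= mule := box_mu dm Bq; have /= mu'le := box_mu dm Bq'.
have mu0 : 0 < mu := lt_le_trans c0 mule.
have mu'0 : 0 < mu' := lt_le_trans c0 mu'le.
have X'r := box_nucsol_bounded d1 dm Bq' SX'; rewrite -/rho in X'r.
have cYb : mx_contraction Yb.
  exact/subgradient_contraction/nucsol_subgradient.
have h1 := sqr_fnorm_image_diff_le K0 hK mu0 mu'0 SX SX'.
have h2 := nucdual_diff_le K0 hK B X mu0 mu'0 SX'.
have h3 := fixed_diff_le mu0 mu'0 SX SX' cYb.
have h4 := hK1 (X - X'); have /= h5 := Yclose _ _ Bq SX.
rewrite -/N -/g in h1 h2 h3.
move: (addr_ge0 (fnorm_ge0 (B - B')) (normr_ge0 (mu - mu'))) h1 h2.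
move: (fnorm (B - B') + _) => d dd h1 h2.
apply: (quadratic_bound (fnorm_ge0 _) dd g0 _ h1).
move: (fnorm_ge0 (nucdual Phi B mu X - nucdual Phi B' mu' X')) h2 h3.
move: (fnorm (nucdual Phi B mu X - nucdual Phi B' mu' X')) => y y0 h2 h3.
have cy : y <= (g * d + K * fnorm (Phi (X - X'))) / c.
  by rewrite ler_pdivlMr// mulrC (le_trans _ h2)// ler_wpM2r.
have h6 : 4 * N * K1 * fnorm (nucdual Phi B mu X - Yb) <= 1.
  rewrite (le_trans (ler_wpM2l NK0 h5))// ler_pdivrMr ?ltr_wpDl//; lra.
have h7 := ler_wpM2r (fnorm_ge0 (X - X')) h6.
have h8 := ler_wpM2l K10 h3.
have h9 : K1 * (2 * N * (fnorm X' * y)) <= K1 * (2 * N * (rho * y)).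
  by rewrite !ler_wpM2l ?mulr_ge0// ler_wpM2r.
have h10 : 4 * K1 * N * rho * y <= s * (g * d + K * fnorm (Phi (X - X'))).
  by rewrite /s -[leRHS]mulrA [c^-1 * _]mulrC ler_wpM2l// mulr_ge0// mulr_ge0// mulr_ge0.
by lra.
Qed.

End Stability.

Lemma param_box_pos_nbhs (R : realType) k (B : 'cV[R]_k) (mu delta : R) :
  0 < mu -> 0 < delta -> delta <= mu / 2 ->
  pos_nbhs (B, mu) (param_box (B, mu) delta).
Proof.
move=> mu0 d0 dm; split; last first.
  by move=> q /(box_mu dm) /(lt_le_trans _); apply; rewrite divr_gt0.
exists ([set B' | fnorm (B' - B) < delta], [set mu' | `|mu' - mu| < delta]).
  split; first exact: nbhs_fnorm.
  by apply/nbhs_ballP; exists delta => //= x; rewrite /ball /= distrC.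
by case=> B' mu' [].
Qed.

Lemma fnorm_pdist (R : realType) k (q q' : 'cV[R]_k * R) :
  fnorm (q.1 - q'.1) + `|q.2 - q'.2| <= 2 * pdist q q'.
Proof.
have p0 : 0 <= pdist q q' by exact: sqrtr_ge0.
have p2 : pdist q q' ^+ 2 = fnorm (q.1 - q'.1) ^+ 2 + `|q.2 - q'.2| ^+ 2.
  by rewrite sqr_sqrtr ?addr_ge0 ?sqr_ge0// real_normK ?num_real.
have h1 : fnorm (q.1 - q'.1) <= pdist q q'.
  by rewrite -(@ler_pXn2r _ 2) ?nnegrE// p2 lerDl sqr_ge0.
have h2 : `|q.2 - q'.2| <= pdist q q'.
  by rewrite -(@ler_pXn2r _ 2) ?nnegrE// p2 lerDr sqr_ge0.
by rewrite mulr_natl mulr2n lerD.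
Qed.

(** * Non-uniqueness for perturbed data *)

Section Perturbation.
Variables (R : realType) (n1 n2 : nat) (hn : (n1 <= n2)%N).
Variables (X Y : 'M[R]_(n1, n2)) (U : 'M[R]_n1) (V : 'M[R]_n2).
Hypotheses (UV : osvd Y (U, V)) (XY : nucnorm_subgradient X Y).
Let p := num_singvals1 Y.

Definition block_embed q (U : 'M[R]_n1) (V : 'M[R]_n2) (A : 'M[R]_q) :
    'M[R]_(n1, n2) :=
  U *m (pid_mx q *m A *m pid_mx q) *m V^T.

Lemma block_embed_linear q (W : 'M[R]_n1) (T : 'M[R]_n2) a (A C : 'M[R]_q) :
  block_embed W T (a *: A + C) = a *: block_embed W T A + block_embed W T C.
Proof.
rewrite /block_embed mulmxDr -scalemxAr mulmxDl -scalemxAl.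
by rewrite mulmxDr -scalemxAr mulmxDl -scalemxAl.
Qed.

(** On the block where the singular values of [Y] equal one, [Y] acts as the
    identity; adding a positive semidefinite block [K K] there keeps the
    duality [<X, Y> = nucnorm X] tight. *)
Lemma subgradient_add_block (K : 'M[R]_p) t : 0 <= t -> K^T = K ->
  nucnorm_subgradient (X + t *: block_embed U V (K *m K)) Y.
Proof.
move=> t0 Ks; have [/= Uo Vo _] := UV.
have cY := subgradient_contraction XY.
have pp l : (p <= l)%N -> (pid_mx p : 'M[R]_(p, l)) *m pid_mx p = 1%:M :> 'M_p.
  by move=> pl; rewrite pid_mx_id// pid_mx_1.
have pn1 : (p <= n1)%N := p_le_n1 Y.
have fpid l (W : 'M[R]_l) : (p <= l)%N -> orthogonal_mx W ->
    fnorm (W *m (pid_mx p *m K)) = fnorm K.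
  move=> pl Wo; rewrite orthogonal_fnorm// /fnorm trdot_mull tr_pid_mx mulmxA.
  by rewrite pp// mul1mx.
have ME : trdot (block_embed U V (K *m K)) Y = fnorm K ^+ 2.
  rewrite /block_embed trdot_mulr trmxK trdot_mull (mulmxA U^T) (osvd_middle UV).
  rewrite trdot_mulr trdot_mull !tr_pid_mx (singvals_mx_pid hn UV cY) pp//.
  by rewrite trdot_mull mulmx1 Ks sqr_fnorm.
apply: contraction_subgradient => //.
rewrite (le_trans (ler_nucnormD _ _))// trdotDl trdotZl (subgradient_trdot XY) ME.
rewrite lerD2l (le_trans (ler_nucnormZ _ t0))// ler_wpM2l//.
have -> : block_embed U V (K *m K) =
    (U *m (pid_mx p *m K)) *m (V *m (pid_mx p *m K))^T.
  by rewrite /block_embed !trmx_mul tr_pid_mx Ks !mulmxA.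
rewrite (le_trans (nucnormM_le _ _))// fnorm_tr !fpid// -?expr2//.
exact: leq_trans hn.
Qed.

End Perturbation.

Section NonUniqueness.
Variables (R : realType) (n1 n2 m : nat) (hn : (n1 <= n2)%N).
Variable Phi : {linear 'M[R]_(n1, n2) -> 'cV[R]_m}.
Variables (B : 'cV[R]_m) (mu : R) (X : 'M[R]_(n1, n2)).
Hypotheses (mu0 : 0 < mu) (SX : nucsol Phi (B, mu) X).
Let Y := nucdual Phi B mu X.
Variables (U : 'M[R]_n1) (V : 'M[R]_n2).
Hypothesis UV : osvd Y (U, V).
Let p := num_singvals1 Y.

(** If [A] is a symmetric block with [Phi A = 0] (in coordinates), the two
    matrices [X + t (1 + A)^2] and [X + t (1 - A)^2] have the same image under
    [Phi], and both solve the problem whose data is shifted by that image. *)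
Lemma nucsol_two_solutions (A : 'M[R]_p) t : 0 <= t -> A^T = A ->
  Phi (block_embed U V A) = 0 ->
  let X1 := X + t *: block_embed U V ((1%:M - A) *m (1%:M - A)) in
  let B1 := B + t *: Phi (block_embed U V ((1%:M - A) *m (1%:M - A))) in
  nucsol Phi (B1, mu) X1 /\
  nucsol Phi (B1, mu) (X1 + (t * 4) *: block_embed U V A).
Proof.
move=> t0 As PA X1 B1.
have XY : nucnorm_subgradient X Y by exact/nucsol_subgradient.
have dual Z : Phi (Z - X1) = 0 -> nucdual Phi B1 mu Z = Y.
  move=> PZ; rewrite /nucdual /Y /nucdual; congr (- (_ *: adjoint Phi _)).
  have -> : Phi Z = Phi X1 by apply/eqP; rewrite -subr_eq0 -linearB PZ.
  by rewrite /X1 /B1 linearD linearZ /= opprD addrACA subrr addr0.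
have sub (K : 'M[R]_p) : K^T = K ->
    nucnorm_subgradient (X + t *: block_embed U V (K *m K)) Y.
  exact: (subgradient_add_block hn UV XY t0).
have X2E : X1 + (t * 4) *: block_embed U V A =
    X + t *: block_embed U V ((1%:M + A) *m (1%:M + A)).
  have -> : (1%:M + A) *m (1%:M + A) =
      4 *: A + (1%:M - A) *m (1%:M - A).
    rewrite !mulmxDl !mulmxDr !mulmx1 !mul1mx mulmxN !mulNmx opprK.
    by move: (A *m A) => C; apply/matrixP => i j; rewrite !mxE; ring.
  by rewrite block_embed_linear scalerDr scalerA -addrA; congr (_ + _); apply: addrC.
split; apply/nucsol_subgradient => //.
  by rewrite dual ?subrr ?linear0//; apply: sub; rewrite linearB /= trmx1 As.
rewrite dual; first by rewrite X2E; apply: sub; rewrite linearD /= trmx1 As.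
by rewrite addrC addKr linearZ /= PA scaler0.
Qed.

End NonUniqueness.

(** * The equivalence *)

Theorem theorem4p7 (R : realType) (n1 n2 m : nat) (hn : (n1 <= n2)%N)
    (Phi : {linear 'M[R]_(n1, n2) -> 'cV[R]_m})
    (Bbar : 'cV[R]_m) (mubar : R) (hmu : 0 < mubar)
    (Xbar : 'M[R]_(n1, n2)) (hX : nucsol Phi (Bbar, mubar) Xbar)
    (Ybar : 'M[R]_(n1, n2))
    (hY : Ybar = - (mubar^-1 *: adjoint Phi (Phi Xbar - Bbar)))
    (p : nat) (hp : p = num_singvals1 Ybar)
    (Ubar : 'M[R]_n1) (Vbar : 'M[R]_n2)
    (hUV : (osvd Xbar `&` osvd Ybar) (Ubar, Vbar)) :
  [<-> [set X | Phi X = 0] `&` sym_block p Ubar Vbar = [set 0];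
       (exists N, [/\ pos_nbhs (Bbar, mubar) N,
                      single_valued_on (nucsol Phi) N
                    & lipschitz_sv_on (nucsol Phi) N])
         /\ nucsol Phi (Bbar, mubar) = [set Xbar];
       (exists N, pos_nbhs (Bbar, mubar) N /\ single_valued_on (nucsol Phi) N)
         /\ nucsol Phi (Bbar, mubar) = [set Xbar] ].
Proof.
rewrite -/(nucdual Phi Bbar mubar Xbar) in hY; subst Ybar p.
have [_ UV] := hUV.
have XY := (nucsol_subgradient Phi Bbar Xbar hmu).1 hX.
have cY := subgradient_contraction XY.
tfae.
- move=> ker0.
  have inj H : Phi H = 0 -> nucdual Phi Bbar mubar Xbar *m H^T *m
      nucdual Phi Bbar mubar Xbar = H -> H = 0.
    move=> PH YH; have : [set 0] H; last by [].
    by rewrite -ker0; split=> //; exact: fixed_sym_block.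
  have [delta [L [d0 dm lip]]] := nucsol_lipschitz hmu hX inj.
  have uniq q X X' : param_box (Bbar, mubar) delta q ->
      nucsol Phi q X -> nucsol Phi q X' -> X = X'.
    move=> Bq SX SX'; have := lip _ _ _ _ Bq Bq SX SX'.
    rewrite !subrr fnorm0 normr0 addr0 mulr0 => le0.
    by apply/eqP; rewrite -subr_eq0 -fnorm_eq0 eq_le le0 fnorm_ge0.
  have Bq0 : param_box (Bbar, mubar) delta (Bbar, mubar).
    by rewrite /param_box /= !subrr fnorm0 normr0.
  split; last first.
    by apply/seteqP; split=> [X SX|X ->] //; exact: uniq Bq0 SX hX.
  exists (param_box (Bbar, mubar) delta); split.
  + exact: param_box_pos_nbhs.
  + move=> [B mu] Bq; have /= mule := box_mu dm Bq.
    have mu0 : 0 < mu by rewrite (lt_le_trans _ mule)// divr_gt0.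
    have [X SX] := nucsol_exists Phi B mu0; exists X.
    by apply/seteqP; split=> [X' SX'|X' ->] //; exact: uniq Bq SX' SX.
  + exists (`|L| * 2) => q q' X X' Bq Bq' SX SX'.
    rewrite (le_trans (lip _ _ _ _ Bq Bq' SX SX'))// -mulrA.
    rewrite (le_trans (ler_wpM2r _ (ler_norm L)))// ?addr_ge0//.
    by rewrite ler_wpM2l// fnorm_pdist.
- by move=> [[N [Nn sv _]] S0]; split=> //; exists N.
- move=> [[N [[[[P1 P2] /= [nP1 nP2] PN] _] sv]] _].
  apply/seteqP; split=> [H [/= PH [A As AH]]|_ ->]; last first.
    split; first by rewrite /= linear0.
    by exists 0; rewrite /= ?trmx0// mulmx0 mul0mx mulmx0 mul0mx.
  rewrite /= in As; rewrite -/(block_embed Ubar Vbar A) in AH.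
  rewrite -{}AH in PH *.
  set Z := Phi (block_embed Ubar Vbar ((1%:M - A) *m (1%:M - A))).
  have /nbhs_ballP[e /= e0 eP1] := nP1.
  have Z1 : 0 < `|Z| + 1 by rewrite ltr_wpDl.
  have [t [t0 te]] : exists t, 0 < t /\ t * (`|Z| + 1) = e.
    by exists (e / (`|Z| + 1)); rewrite divr_gt0// divfK// gt_eqF.
  have Nq : N (Bbar + t *: Z, mubar).
    apply: PN; split => /=; last exact: nbhs_singleton.
    apply: eP1; rewrite mx_norm_ball /ball_ /= opprD addNKr normrN normrZ gtr0_norm//.
    by rewrite -te ltr_pM2l// ltrDl.
  have [S1 S2] := nucsol_two_solutions hn hmu hX UV (ltW t0) As PH.
  have [x Sx] := sv _ Nq; rewrite Sx /= in S1 S2.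
  have := etrans S2 (esym S1); rewrite -[RHS]addr0 => /addrI/eqP.
  by rewrite scaler_eq0 mulf_eq0 gt_eqF//= pnatr_eq0 => /eqP.
Qed.
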